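(* Let $(\Omega_1,\mathcal{F}_1)$, $(\Omega_2,\mathcal{F}_2)$ be measurable spaces, $\Omega:=\Omega_1\times\Omega_2$, $\mathcal{F}:=\mathcal{F}_1\otimes\mathcal{F}_2$, let $\mathcal{P}_i\subseteq\mathfrak{P}(\Omega_i)$ be non-empty, $i=1,2$, and let $\mathcal{P}$ be the set of all probability measures $P$ on $(\Omega,\mathcal{F})$ with $P[\,\cdot\times\Omega_2]\in\mathcal{P}_1$ and $P[\Omega_1\times\cdot\,]\in\mathcal{P}_2$. Let $c_1,c_2,c$ be the upper probabilities of $\mathcal{P}_1,\mathcal{P}_2,\mathcal{P}$. For $i=1,2$ let $\mathcal{C}_i\subseteq L^0_{c_i+}(\Omega_i)$ be non-empty, convex, solid, $\mathcal{P}_i$-sensitive, and sequentially order closed, and let $$\mathcal{M}_i:=\Big\{\mu\in ca_{c_i+}(\Omega_i):\forall X\in\mathcal{C}_i\ \int X\,d\mu\le 1\Big\}.$$ Let $\mathcal{M}$ be the set of $\mu\in ca_{c+}(\Omega)$ with $\mu[\,\cdot\times\Omega_2]\in\mathcal{M}_1$ and $\mu[\Omega_1\times\cdot\,]\in\mathcal{M}_2$. For $Y\in L^0_{c+}(\Omega)$ let $$\Psi_Y:=\{(Y_1,Y_2)\in L^0_{c_1+}(\Omega_1)\times L^0_{c_2+}(\Omega_2): Y\preccurlyeq_{\mathcal{P}}Y_1\oplus Y_2\},$$ and set $$\mathcal{D}:=\Big\{Y\in L^0_{c+}(\Omega):\sup_{\mu\in\mathcal{M}}\int Y\,d\mu\le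 1\Big\},$$ $$\mathcal{C}:=\Big\{Y\in L^0_{c+}(\Omega):\exists (Y_1,Y_2)\in\Psi_Y\ \ \sup_{\mu_1\in\mathcal{M}_1}\int Y_1\,d\mu_1+\sup_{\mu_2\in\mathcal{M}_2}\int Y_2\,d\mu_2\le 1\Big\}.$$ Then $\mathcal{C}^{\circ\circ}_{ca}=\mathcal{D}^{\circ\circ}_{ca}=\mathcal{D}$. Moreover, $\mathcal{C}=\mathcal{D}$ if and only if $\mathcal{C}$ is $\mathcal{P}$-sensitive and sequentially order closed.
   Context: The following notation is used for a measurable space $(\Omega,\mathcal{F})$ with a non-empty set $\mathcal{P}$ of probability measures, and analogously for $(\Omega_i,\mathcal{F}_i)$ with $\mathcal{P}_i$ and $c_i$. $\mathfrak{P}(\Omega)$ is the set of probability measures. $c[A]:=\sup_{P\in\mathcal{P}}P[A]$ is the upper probability. An event $A$ is $\mathcal{P}$-polar if $c[A]=0$; a property holds $\mathcal{P}$-q.s. if it holds outside a $\mathcal{P}$-polar event. $ca_{c+}(\Omega)$ is the set of finite measures $\mu$ on $(\Omega,\mathcal{F})$ with $\mu[N]=0$ for every $\mathcal{P}$-polar $N$, and $\mathfrak{P}_c(\Omega)$ the set of probability measures in $ca_{c+}(\Omega)$. $L^0_c(\Omega)$ is the space of real-valued random variables modulo $\mathcal{P}$-q.s. equality, ordered by $X\preccurlyeq_{\mathcal{P}}Y$ iff $X\le Y$ $\mathcal{P}$-q.s.; $L^0_{c+}(\Omega)$ is its positive cone. Integrals of $X\in L^0_{c+}(\Omega)$ against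 $\mu\in ca_{c+}(\Omega)$ are evaluated on any representative, with values in $[0,\infty]$. For $X_i\in L^0_{c_i}(\Omega_i)$, $X_1\oplus X_2\in L^0_c(\Omega)$ is the class of $(\omega_1,\omega_2)\mapsto f_1(\omega_1)+f_2(\omega_2)$ with $f_i\in X_i$. For non-empty $\mathcal{C}\subseteq L^0_{c+}(\Omega)$: $\mathcal{C}^\circ_{ca}:=\{\mu\in ca_{c+}(\Omega):\forall X\in\mathcal{C}\ \int X\,d\mu\le 1\}$ and $\mathcal{C}^{\circ\circ}_{ca}:=\{X\in L^0_{c+}(\Omega):\forall\mu\in\mathcal{C}^\circ_{ca}\ \int X\,d\mu\le 1\}$. For $Q\in\mathfrak{P}_c(\Omega)$, $L^0_Q$ denotes random variables modulo $Q$-a.s. equality, and $j_Q:L^0_c(\Omega)\to L^0_Q$ maps the $\mathcal{P}$-q.s. class of $f$ to its $Q$-a.s. class. $\mathcal{C}\subseteq L^0_c(\Omega)$ is $\mathcal{P}$-sensitive if $\mathcal{C}=\bigcap_{Q\in\mathfrak{P}_c(\Omega)}j_Q^{-1}(j_Q(\mathcal{C}))$. $\mathcal{C}\subseteq L^0_{c+}(\Omega)$ is solid if $X\in\mathcal{C}$, $Y\in L^0_{c+}(\Omega)$, $Y\preccurlyeq_{\mathcal{P}}X$ imply $Y\in\mathcal{C}$. A sequence $(X_n)\subset L^0_c$ is order convergent to $X\in L^0_c$ if there is a decreasing sequence $(Y_n)\subset L^0_c$ with $\inf_nY_n=0$ in $L^0_c$ and $|X_n-X|\preccurlyeq_{\mathcal{P}}Y_n$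 for all $n$. A set is sequentially order closed if it contains every element of $L^0_c$ that is the order limit of a sequence of its elements. *)

(* Defs.v *)
From HB Require Import structures.
From mathcomp Require Import all_boot all_order all_algebra.
From mathcomp Require Import all_classical all_reals all_analysis measurable_realfun.
Set Implicit Arguments.
Unset Strict Implicit.
Unset Printing Implicit Defensive.
Import Order.TTheory GRing.Theory Num.Theory.
Import numFieldNormedType.Exports.

Local Open Scope classical_set_scope.
Local Open Scope ring_scope.
Local Open Scope quotient_scope.

Section quasi_sure.
Context d (T : measurableType d) (R : realType).
Variable P : set (probability T R).

Definition upper_prob (A : set T) : \bar R :=
  ereal_sup [set Q A | Q in P].

(* For non-empty [P] the bound reads [upper_prob N = 0], see [polarP]; with
   [<=] quasi-sure equality is an equivalence relation for every [P]. *)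
Definition polar (N : set T) : Prop :=
  measurable N /\ (upper_prob N <= 0)%E.

Lemma polarE (N : set T) :
  polar N <-> measurable N /\ forall Q, P Q -> Q N = 0%E.
Proof.
split=> [[mN N0]|[mN N0]]; split=> //.
  move=> Q PQ; apply/eqP; rewrite eq_le measure_ge0 andbT.
  by apply: le_trans N0; apply: ereal_sup_ubound; exists Q.
by apply: ge_ereal_sup => _ [Q PQ <-]; rewrite N0.
Qed.

Lemma polarP (N : set T) : P !=set0 ->
  polar N <-> measurable N /\ upper_prob N = 0%E.
Proof.
move=> [Q PQ]; split=> [[mN N0]|[mN N0]]; split=> //; last by rewrite N0.
apply/eqP; rewrite eq_le N0/=; apply: le_trans (measure_ge0 Q N) _.
by apply: ereal_sup_ubound; exists Q.
Qed.

Definition qs : set_system T :=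
  [set A | exists2 N, polar N & ~` N `<=` A].

Global Instance qs_filter : Filter qs.
Proof.
split.
- exists set0 => //; apply/polarE; split=> // Q _; exact: measure0.
- move=> A B [N /polarE[mN N0] NA] [M /polarE[mM M0] MB]; exists (N `|` M).
    apply/polarE; split; first exact: measurableU.
    by move=> Q PQ; apply: null_set_setU => //; [exact: N0|exact: M0].
  by move=> w; rewrite setCU => -[/NA ? /MB].
- by move=> A B AB [N pN NA]; exists N => //; apply: subset_trans AB.
Qed.

Definition qs_eq_op (f g : {mfun T >-> R}) : bool :=
  `[< \forall w \near qs, f w = g w >].

Let qs_eq_op_refl : reflexive qs_eq_op.
Proof. by move=> f; apply/asboolP; exact: nearW. Qed.

Let qs_eq_op_sym : symmetric qs_eq_op.
Proof.
by move=> f g; apply/idP/idP => /asboolP h; apply/asboolP;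
  apply: filterS h => w.
Qed.

Let qs_eq_op_trans : transitive qs_eq_op.
Proof.
move=> f g h /asboolP gf /asboolP fh; apply/asboolP.
by apply: filterS2 gf fh => w -> ->.
Qed.

Canonical qs_eq_op_canonical :=
  EquivRel qs_eq_op qs_eq_op_refl qs_eq_op_sym qs_eq_op_trans.

Definition L0 : Type := {eq_quot qs_eq_op}.
HB.instance Definition _ := Choice.on L0.
HB.instance Definition _ := EqQuotient.on L0.

Definition L0_to_fun (X : L0) : {mfun T >-> R} := repr X.
Coercion L0_to_fun : L0 >-> MeasurableFun.type.

Definition L0_class (f : {mfun T >-> R}) : L0 := \pi f.

Lemma L0P (f g : {mfun T >-> R}) :
  L0_class f = L0_class g <-> \forall w \near qs, f w = g w.
Proof.
by split=> [/eqP|fg]; [rewrite eqmodE => /asboolP|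
  apply/eqP; rewrite eqmodE; exact/asboolP].
Qed.

Lemma L0_classK (X : L0) : L0_class X = X.
Proof. exact: reprK. Qed.

Lemma L0W (K : L0 -> Prop) : (forall f, K (L0_class f)) -> forall X, K X.
Proof. by move=> Kf X; rewrite -(L0_classK X). Qed.

Lemma L0_classE (f : {mfun T >-> R}) : \forall w \near qs, L0_class f w = f w.
Proof. by apply/L0P; rewrite L0_classK. Qed.

End quasi_sure.
Arguments L0 {d T R} P.

Section L0_structures.
Context d (T : measurableType d) (R : realType).
Variable P : set (probability T R).
Local Notation L0 := (L0 P).
Local Notation class := (@L0_class d T R P).
Implicit Types (X Y Z : L0) (a b : R).

Let add X Y : L0 := class ((X : {mfun T >-> R}) + (Y : {mfun T >-> R})).
Let opp X : L0 := class (- (X : {mfun T >-> R})).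
Let zero : L0 := class (0 : {mfun T >-> R}).
Let scale a X : L0 := class (a *: (X : {mfun T >-> R})).

Let addE (f g : {mfun T >-> R}) : add (class f) (class g) = class (f + g).
Proof.
apply/L0P; apply: filterS2 (L0_classE P f) (L0_classE P g) => w.
by rewrite !mfunD/= => -> ->.
Qed.

Let oppE (f : {mfun T >-> R}) : opp (class f) = class (- f).
Proof.
by apply/L0P; apply: filterS (L0_classE P f) => w; rewrite !mfunN/= => ->.
Qed.

Let scaleE a (f : {mfun T >-> R}) : scale a (class f) = class (a *: f).
Proof.
by apply/L0P; apply: filterS (L0_classE P f) => w /= fE; congr (a * _).
Qed.

Let addA : associative add.
Proof. by elim/L0W=> f; elim/L0W=> g; elim/L0W=> h; rewrite !addE addrA. Qed.
Let addC : commutative add.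
Proof. by elim/L0W=> f; elim/L0W=> g; rewrite !addE addrC. Qed.
Let add0 : left_id zero add.
Proof. by elim/L0W=> f; rewrite !addE add0r. Qed.
Let addN : left_inverse zero opp add.
Proof. by elim/L0W=> f; rewrite oppE addE addNr. Qed.

HB.instance Definition _ := GRing.isZmodule.Build L0 addA addC add0 addN.

Let scaleA a b X : scale a (scale b X) = scale (a * b) X.
Proof. by elim/L0W: X => f; rewrite !scaleE scalerA. Qed.
Let scale1 : left_id 1 scale.
Proof. by elim/L0W=> f; rewrite scaleE scale1r. Qed.
Let scaleDr : right_distributive scale +%R.
Proof.
by move=> a; elim/L0W=> f; elim/L0W=> g;
  rewrite ?[_ + _]addE !scaleE ?[_ + _]addE scalerDr.
Qed.
Let scaleDl X : {morph scale^~ X : a b / a + b}.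
Proof.
by move=> a b; elim/L0W: X => f;
  rewrite !scaleE [in RHS]/GRing.add/= addE scalerDl.
Qed.

HB.instance Definition _ :=
  GRing.Zmodule_isLmodule.Build R L0 scaleA scale1 scaleDr scaleDl.

Lemma L0_class0 : class (0 : {mfun T >-> R}) = 0. Proof. by []. Qed.

Lemma L0_classD (f g : {mfun T >-> R}) : class (f + g) = class f + class g.
Proof. exact/esym/addE. Qed.

Lemma L0_classN (f : {mfun T >-> R}) : class (- f) = - class f.
Proof. exact/esym/oppE. Qed.

Lemma L0_classZ a (f : {mfun T >-> R}) : class (a *: f) = a *: class f.
Proof. exact/esym/scaleE. Qed.

Definition L0_le X Y : bool := `[< \forall w \near qs P, X w <= Y w >].

Let L0_le_refl : reflexive L0_le.
Proof. by move=> X; apply/asboolP; exact: nearW. Qed.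

Let L0_le_anti : antisymmetric L0_le.
Proof.
move=> X Y /andP[/asboolP XY /asboolP YX].
rewrite -(L0_classK X) -(L0_classK Y); apply/L0P.
by apply: filterS2 XY YX => w Xw Yw; apply/eqP; rewrite eq_le Xw.
Qed.

Let L0_le_trans : transitive L0_le.
Proof.
move=> Y X Z /asboolP XY /asboolP YZ; apply/asboolP.
by apply: filterS2 XY YZ => w; exact: le_trans.
Qed.

HB.instance Definition _ := Order.Le_isPOrder.Build ring_display L0
  L0_le_refl L0_le_anti L0_le_trans.

Lemma le_L0_class (f g : {mfun T >-> R}) :
  class f <= class g <-> \forall w \near qs P, f w <= g w.
Proof.
split=> [/asboolP|] fg; [|apply/asboolP];
  by apply: filterS3 fg (L0_classE P f) (L0_classE P g) => w + fE gE; rewrite fE gE.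
Qed.

Definition L0_abs X : L0 := class (@Num.norm R R \o X : {mfun T >-> R}).

Lemma L0_abs_class (f : {mfun T >-> R}) :
  L0_abs (class f) = class (@Num.norm R R \o f : {mfun T >-> R}).
Proof. by apply/L0P; apply: filterS (L0_classE P f) => w /= ->. Qed.

Definition L0_pos : set L0 := [set X | 0 <= X].

Definition ca_c_pos : set {finite_measure set T -> \bar R} :=
  [set mu | forall N, polar P N -> mu N = 0%E].

Definition prob_c : set (probability T R) :=
  [set Q | ca_c_pos Q].

Definition L0_integral (mu : {finite_measure set T -> \bar R}) X : \bar R :=
  (\int[mu]_w (X w)%:E)%E.

Lemma L0_integral_class (mu : {finite_measure set T -> \bar R})
    (f : {mfun T >-> R}) : ca_c_pos mu ->
  L0_integral mu (class f) = (\int[mu]_w (f w)%:E)%E.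
Proof.
move=> muP; apply: ae_eq_integral => //.
- exact/measurable_EFinP.
- exact/measurable_EFinP.
have [N pN NE] := L0_classE P f; exists N; split; [by case: pN|exact: muP|].
by move=> w /=; apply: contra_notP => /NE fE _; rewrite /= fE.
Qed.

Definition ca_polar (C : set L0) : set {finite_measure set T -> \bar R} :=
  [set mu | ca_c_pos mu /\ forall X, C X -> (L0_integral mu X <= 1)%E].

Definition ca_bipolar (C : set L0) : set L0 :=
  [set X | 0 <= X /\
    forall mu, ca_polar C mu -> (L0_integral mu X <= 1)%E].

Definition L0_proj (Q : probability T R) X : {mfun_ Q, T >-> R} :=
  \pi_({mfun_ Q, T >-> R}) (X : {mfun T >-> R}).

Lemma L0_proj_class (Q : probability T R) (f : {mfun T >-> R}) : prob_c Q ->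
  L0_proj Q (class f) = \pi_({mfun_ Q, T >-> R}) f.
Proof.
move=> QP; apply/eqP; rewrite eqmodE; apply/asboolP.
have [N pN NE] := L0_classE P f; exists N; split; [by case: pN|exact: QP|].
by move=> w /=; apply: contra_notP => /NE fE _.
Qed.

Definition sensitive (C : set L0) : Prop :=
  C = \bigcap_(Q in prob_c) (L0_proj Q @^-1` (L0_proj Q @` C)).

Definition solid (C : set L0) : Prop :=
  forall X Y, C X -> 0 <= Y -> Y <= X -> C Y.

Definition order_cvg (X_ : nat -> L0) X : Prop :=
  exists Y_ : nat -> L0,
    [/\ nonincreasing_seq Y_, infimums (range Y_) 0 &
        forall n, L0_abs (X_ n - X) <= Y_ n].

Definition seq_order_closed (C : set L0) : Prop :=
  forall (X_ : nat -> L0) X, (forall n, C (X_ n)) -> order_cvg X_ X -> C X.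

End L0_structures.
Arguments L0_pos {d T R} P.
Arguments ca_c_pos {d T R} P.
Arguments prob_c {d T R} P.

Section product.
Context d1 d2 (T1 : measurableType d1) (T2 : measurableType d2) (R : realType).

Definition fst_marginal (mu : set (T1 * T2) -> \bar R) (A : set T1) : \bar R :=
  mu (A `*` setT).
Definition snd_marginal (mu : set (T1 * T2) -> \bar R) (A : set T2) : \bar R :=
  mu (setT `*` A).

(* A measure is a function on all subsets, with unspecified values outside the
   sigma-algebra; equality of measures has to be tested on measurable sets. *)
Definition eq_measurable d (T : measurableType d) (mu nu : set T -> \bar R) :=
  forall A, measurable A -> mu A = nu A.

Definition couplings (P1 : set (probability T1 R)) (P2 : set (probability T2 R))
    : set (probability (T1 * T2)%type R) :=
  [set P | (exists2 Q1, P1 Q1 & eq_measurable (fst_marginal P) Q1) /\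
           (exists2 Q2, P2 Q2 & eq_measurable (snd_marginal P) Q2)].

Let oplus_fun_measurable (f1 : {mfun T1 >-> R}) (f2 : {mfun T2 >-> R}) :
  measurable_fun setT (fun w : T1 * T2 => f1 w.1 + f2 w.2).
Proof. by apply: measurable_funD; apply: measurableT_comp. Qed.

Definition oplus_fun (f1 : T1 -> R) (f2 : T2 -> R) (w : T1 * T2) : R :=
  f1 w.1 + f2 w.2.

HB.instance Definition _ (f1 : {mfun T1 >-> R}) (f2 : {mfun T2 >-> R}) :=
  isMeasurableFun.Build _ _ _ _ (oplus_fun f1 f2) (oplus_fun_measurable f1 f2).

Variables (P1 : set (probability T1 R)) (P2 : set (probability T2 R)).
Local Notation P := (couplings P1 P2).

Definition oplus (X1 : L0 P1) (X2 : L0 P2) : L0 P :=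
  L0_class P (oplus_fun X1 X2 : {mfun (T1 * T2)%type >-> R}).

Lemma oplus_class (f1 : {mfun T1 >-> R}) (f2 : {mfun T2 >-> R}) :
  oplus (L0_class P1 f1) (L0_class P2 f2) =
  L0_class P (oplus_fun f1 f2 : {mfun (T1 * T2)%type >-> R}).
Proof.
apply/L0P.
have [N1 /polarE[mN1 N10] N1E] := L0_classE P1 f1.
have [N2 /polarE[mN2 N20] N2E] := L0_classE P2 f2.
exists ((N1 `*` setT) `|` (setT `*` N2)).
  have mN1T : measurable (N1 `*` [set: T2]) by exact: measurableX.
  have mTN2 : measurable ([set: T1] `*` N2) by exact: measurableX.
  apply/polarE; split; first exact: measurableU.
  move=> Q [[Q1 PQ1 QE1] [Q2 PQ2 QE2]]; apply: null_set_setU => //.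
  - by rewrite -[LHS]/(fst_marginal Q N1) QE1// N10.
  - by rewrite -[LHS]/(snd_marginal Q N2) QE2// N20.
move=> [w1 w2]; rewrite setCU => -[/= w1N w2N]; rewrite /oplus_fun/=.
rewrite N1E ?N2E//.
- by move=> w2N2; apply: w2N.
- by move=> w1N1; apply: w1N.
Qed.

Definition marginals_in (M1 : set {finite_measure set T1 -> \bar R})
    (M2 : set {finite_measure set T2 -> \bar R})
    : set {finite_measure set (T1 * T2)%type -> \bar R} :=
  [set mu | [/\ ca_c_pos P mu,
    exists2 mu1, M1 mu1 & eq_measurable (fst_marginal mu) mu1 &
    exists2 mu2, M2 mu2 & eq_measurable (snd_marginal mu) mu2]].

Definition superhedges (Y : L0 P) : set (L0 P1 * L0 P2) :=
  [set Y12 | [/\ 0 <= Y12.1, 0 <= Y12.2 & Y <= oplus Y12.1 Y12.2]].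

End product.

Definition sup_integral d (T : measurableType d) (R : realType)
    (P : set (probability T R)) (M : set {finite_measure set T -> \bar R})
    (Y : L0 P) : \bar R :=
  ereal_sup [set L0_integral mu Y | mu in M].

(* Main.v *)
(* The two bipolar identities are elementary: pairing $X \in C_1$ with $0$ (and
   symmetrically) gives members of $C$, so measures in the polar of $C$ have
   their marginals in $M_1$ and $M_2$, i.e. the polar of $C$ is contained in $M$,
   while $C \subseteq D$ and $D$ is the set polar to $M$.

   For the equivalence, $D$ is always sensitive (normalise the measures) and
   sequentially order closed (an order convergent sequence converges
   quasi-surely; Fatou).  Conversely, a convex solid sensitive sequentially
   order closed set $C$ is its own bipolar: if $Y \notin C$, sensitivity yields
   $Q$ such that $Y$ is $Q$-a.s. different from every element of $C$; after
   rescaling by $e^{-Y}$, the element $X_0$ of $C$ below $Y$ closest to $Y$ in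
   $L^2(Q)$ gives a nonnegative bounded density $Y - X_0$ that separates $Y$
   from $C$. *)
Require Import Defs.
From HB Require Import structures.
From mathcomp Require Import all_boot all_order all_algebra.
From mathcomp Require Import all_classical all_reals all_analysis measurable_realfun.
From mathcomp Require Import ring lra.
Import Order.TTheory GRing.Theory Num.Theory.
Import numFieldNormedType.Exports.
Set Implicit Arguments.
Unset Strict Implicit.
Unset Printing Implicit Defensive.

Local Open Scope classical_set_scope.
Local Open Scope ring_scope.

(** * Real-valued expectations of bounded measurable functions *)

Section bounded_expectation.
Context d (T : measurableType d) (R : realType).
Variable Q : probability T R.
Implicit Types f g : T -> R.

(** The bound is required at every point, so that sums, products and powers inherit it pointwise and
    every expectation below is finite. *)
Definition bounded_mfun f : Prop :=
  measurable_fun setT f /\ exists M : R, forall x, `|f x| <= M.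

Definition mean f : R := \int[Q]_x f x.

Lemma bounded_mfunD f g : bounded_mfun f -> bounded_mfun g ->
  bounded_mfun (fun x => f x + g x).
Proof.
move=> [mf [M fM]] [mg [N gN]]; split; first exact: measurable_funD.
by exists (M + N) => x; apply: le_trans (ler_normD _ _) _; exact: lerD.
Qed.

Lemma bounded_mfunM f g : bounded_mfun f -> bounded_mfun g ->
  bounded_mfun (fun x => f x * g x).
Proof.
move=> [mf [M fM]] [mg [N gN]]; split; first exact: measurable_funM.
by exists (M * N) => x; rewrite normrM; exact: ler_pM.
Qed.

Lemma bounded_mfun_cst r : bounded_mfun (fun=> r).
Proof. by split => //; exists `|r|. Qed.

Lemma bounded_mfunZ r f : bounded_mfun f -> bounded_mfun (fun x => r * f x).
Proof. by move=> bf; apply: bounded_mfunM => //; exact: bounded_mfun_cst. Qed.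

Lemma bounded_mfunN f : bounded_mfun f -> bounded_mfun (fun x => - f x).
Proof.
move=> [mf [M fM]]; split; first exact: measurableT_comp.
by exists M => x; rewrite normrN.
Qed.

Lemma bounded_mfunB f g : bounded_mfun f -> bounded_mfun g ->
  bounded_mfun (fun x => f x - g x).
Proof. by move=> bf bg; apply: bounded_mfunD => //; exact: bounded_mfunN. Qed.

Lemma bounded_mfunX f n : bounded_mfun f -> bounded_mfun (fun x => f x ^+ n).
Proof.
move=> bf; elim: n => [|n ih]; first exact: bounded_mfun_cst.
under eq_fun do rewrite exprS.
exact: bounded_mfunM.
Qed.

Lemma bounded_mfun_norm f : bounded_mfun f -> bounded_mfun (fun x => `|f x|).
Proof.
move=> [mf [M fM]]; split; first exact: measurableT_comp.
by exists M => x; rewrite normr_id.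
Qed.

Lemma bounded_mfun_itv f (a b : R) : measurable_fun setT f ->
  (forall x, a <= f x <= b) -> bounded_mfun f.
Proof.
move=> mf fab; split => //; exists (`|a| + `|b|) => x.
have /andP[af fb] := fab x; rewrite ler_norml; apply/andP; split.
  rewrite lerNl; apply: le_trans (_ : `|a| <= _); last by rewrite lerDl.
  by rewrite lerNl; apply: le_trans af; rewrite lerNl -normrN ler_norm.
apply: le_trans fb _; apply: le_trans (ler_norm b) _.
by rewrite lerDr.
Qed.

Lemma bounded_mfun_integrable f : bounded_mfun f ->
  Q.-integrable setT (EFin \o f).
Proof.
move=> [mf [M fM]]; apply: measurable_bounded_integrable => //.
  by rewrite (le_lt_trans (probability_le1 Q measurableT)) ?ltry.
exists M; split; first exact: num_real.
by move=> r Mr x _; apply: le_trans (ltW Mr); exact: fM.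
Qed.

Lemma mean_ge0 f : (forall x, 0 <= f x) -> 0 <= mean f.
Proof. by move=> f0; apply: Rintegral_ge0. Qed.

Lemma EFin_mean f : bounded_mfun f -> (mean f)%:E = (\int[Q]_x (f x)%:E)%E.
Proof.
by move=> bf; rewrite fineK// integrable_fin_num//; exact: bounded_mfun_integrable.
Qed.

Lemma meanD f g : bounded_mfun f -> bounded_mfun g ->
  mean (fun x => f x + g x) = mean f + mean g.
Proof. by move=> bf bg; apply: RintegralD => //; exact: bounded_mfun_integrable. Qed.

Lemma meanB f g : bounded_mfun f -> bounded_mfun g ->
  mean (fun x => f x - g x) = mean f - mean g.
Proof. by move=> bf bg; apply: RintegralB => //; exact: bounded_mfun_integrable. Qed.

Lemma meanZ r f : bounded_mfun f -> mean (fun x => r * f x) = r * mean f.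
Proof. by move=> bf; apply: RintegralZl => //; exact: bounded_mfun_integrable. Qed.

Lemma mean_cst r : mean (fun=> r) = r.
Proof.
rewrite /mean Rintegral_cst//; transitivity (r * fine (1 : \bar R)); last exact: mulr1.
by congr (r * fine _); exact: probability_setT.
Qed.

Lemma le_mean f g : bounded_mfun f -> bounded_mfun g ->
  (forall x, f x <= g x) -> mean f <= mean g.
Proof. by move=> bf bg fg; apply: le_Rintegral => //; exact: bounded_mfun_integrable. Qed.

End bounded_expectation.

(** * Projection on solid closed convex sets *)

Section liminf_mean.
Context d (T : measurableType d) (R : realType).
Variable Q : probability T R.

(** Young's inequality $2|u| \le c u^2 + c^{-1}$, integrated. It replaces Cauchy-Schwarz; the weight
    [c] is left free. *)
Lemma mean_norm_le (u : T -> R) (c : R) : bounded_mfun u -> 0 < c ->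
  mean Q (fun x => `|u x|) <= (c * mean Q (fun x => u x ^+ 2) + c^-1) / 2.
Proof.
move=> bu c0.
rewrite -(mean_cst Q c^-1) -meanZ; last exact: bounded_mfunX.
rewrite -meanD; [|exact/bounded_mfunZ/bounded_mfunX|exact: bounded_mfun_cst].
rewrite mulrC -meanZ; last first.
  by apply: bounded_mfunD; [exact/bounded_mfunZ/bounded_mfunX|exact: bounded_mfun_cst].
apply: le_mean; first exact: bounded_mfun_norm.
  apply/bounded_mfunZ/bounded_mfunD; first exact/bounded_mfunZ/bounded_mfunX.
  exact: bounded_mfun_cst.
move=> x; rewrite -real_normK ?num_real//; set a := `|u x|.
have : 0 <= c * (a - c^-1) ^+ 2 by rewrite mulr_ge0 ?sqr_ge0// ltW.
suff -> : c * (a - c^-1) ^+ 2 = c * a ^+ 2 - 2 * a + c^-1 by lra.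
by field; rewrite gt_eqF.
Qed.

Lemma infs_ge0_le (u : nat -> R) n : (forall k, 0 <= u k) -> 0 <= infs u n <= u n.
Proof.
move=> u0; apply/andP; split.
  by apply: lb_le_inf; [exists (u n); exists n => /=|move=> _ [k _ <-]].
by apply: ge_inf; [exists 0 => _ [k _ <-]|exists n => /=].
Qed.

(** Each [u m - u (m + k)] telescopes to at most the sum of the absolute increments; then take the
    infimum over [k]. The series lives in the extended reals since it may diverge. *)
Lemma sub_infs_le_nneseries (u : nat -> R) m : (forall k, 0 <= u k) ->
  ((u m - infs u m)%:E <= \sum_(n <oo) `|u (m + n)%N - u (m + n).+1|%:E)%E.
Proof.
move=> u0; set S := (\sum_(_ <oo) _)%E.
have uS k : ((u m - u (m + k)%N)%:E <= S)%E.
  apply: (@le_trans _ _ (\sum_(0 <= n < k) `|u (m + n)%N - u (m + n).+1|%:E)%E).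
    rewrite sumEFin lee_fin; elim: k => [|k ih]; first by rewrite addn0 subrr big_nil.
    rewrite big_nat_recr//= addnS; apply: le_trans (lerD ih (ler_norm _)).
    by rewrite addrA subrK.
  by apply: nneseries_lim_ge => n _; rewrite lee_fin.
have S0 : (0 <= S)%E by apply: nneseries_ge0 => n _; rewrite lee_fin.
move: S0 uS; case: S => [s| |] // _ uS; last by rewrite leey.
rewrite lee_fin lerBlDr addrC -lerBlDr; apply: lb_le_inf.
  by exists (u m); exists m => /=.
move=> _ [k /= mk <-]; have := uS (k - m)%N; rewrite subnKC// lee_fin; lra.
Qed.

(* The telescoping bound $f_m - \inf_{k\ge m} f_k \le \sum_{k\ge m} |f_k - f_{k+1}|$
   replaces the extraction of an a.s. convergent subsequence. *)
Lemma mean_sub_infs_le (f_ : nat -> T -> R) (C : R) m :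
  (forall k, measurable_fun setT (f_ k)) ->
  (forall k x, 0 <= f_ k x <= 1) ->
  (forall k, mean Q (fun x => `|f_ k x - f_ k.+1 x|) <= C / 2 ^+ k) ->
  mean Q (fun x => f_ m x - infs (f_ ^~ x) m) <= 2 * C / 2 ^+ m.
Proof.
move=> mf f01 fC.
have f0 k x : 0 <= f_ k x by case/andP: (f01 k x).
have bf k : bounded_mfun (f_ k) by exact: bounded_mfun_itv (f01 k).
have minf : measurable_fun setT (fun x => infs (f_ ^~ x) m).
  by apply: measurable_fun_infs => // x _; exists 0 => _ [k _ <-].
have binf : bounded_mfun (fun x => infs (f_ ^~ x) m).
  apply: (@bounded_mfun_itv _ _ _ _ 0 1) => // x.
  have /andP[-> /le_trans->//] : 0 <= infs (f_ ^~ x) m <= f_ m x.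
    by apply: infs_ge0_le => k.
  by case/andP: (f01 m x).
rewrite -lee_fin EFin_mean; last exact: bounded_mfunB.
have mD k : measurable_fun setT (fun x => `|f_ k x - f_ k.+1 x|%:E).
  by apply/measurable_EFinP; apply: measurableT_comp => //; exact: measurable_funB.
apply: (@le_trans _ _
  (\int[Q]_x \sum_(n <oo) `|f_ (m + n)%N x - f_ (m + n).+1 x|%:E)%E).
  apply: ge0_le_integral => //.
  - by move=> x _; rewrite lee_fin subr_ge0;
      have /andP[] : 0 <= infs (f_ ^~ x) m <= f_ m x by exact: infs_ge0_le.
  - by apply/measurable_EFinP; exact: measurable_funB.
  - apply: ge0_emeasurable_sum => //.
  - by move=> x _; apply: (@sub_infs_le_nneseries (f_ ^~ x)).
rewrite integral_nneseries//.
apply: lime_le.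
  by apply: is_cvg_nneseries => n _ _; apply: integral_ge0.
apply: nearW => n.
apply: (@le_trans _ _ (\sum_(0 <= k < n) (C / 2 ^+ (m + k))%:E)%E).
  by apply: lee_sum => k _; rewrite -EFin_mean ?lee_fin//;
    exact/bounded_mfun_norm/bounded_mfunB.
have C0 : 0 <= C.
  by have := fC 0; rewrite expr0 divr1; apply: le_trans; exact: mean_ge0.
rewrite sumEFin lee_fin.
(* Geometric sum in closed form; the last factor is at most 1 for every [n]. *)
suff -> : \sum_(0 <= k < n) C / 2 ^+ (m + k) = 2 * C / 2 ^+ m * (1 - (2 ^+ n)^-1).
  rewrite ler_piMr// ?lerBlDr ?lerDl ?invr_ge0 ?exprn_ge0//.
  by rewrite divr_ge0 ?exprn_ge0// mulr_ge0.
elim: n => [|n ih]; first by rewrite big_nil expr0 invr1 subrr mulr0.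
rewrite big_nat_recr//= ih exprD exprS; field.
by rewrite !expf_neq0.
Qed.

End liminf_mean.

(** The hypotheses on classes, restated for functions defined everywhere and without reference to a
    measure, so that one [K] can be projected in $L^2(Q)$ for any [Q]. *)
Record closed_solid_convex d (T : measurableType d) (R : realType)
    (K : set (T -> R)) : Prop := ClosedSolidConvex {
  csc_neq0 : K !=set0 ;
  csc_measurable : forall f, K f -> measurable_fun setT f ;
  csc_ge0 : forall f, K f -> forall x, 0 <= f x ;
  csc_solid : forall f g : T -> R, K f -> measurable_fun setT g ->
    (forall x, 0 <= g x <= f x) -> K g ;
  csc_convex : forall (f g : T -> R) t, K f -> K g -> 0 <= t <= 1 ->
    K (fun x => (1 - t) * f x + t * g x) ;
  csc_cvg : forall (f_ : nat -> T -> R) f, (forall n, K (f_ n)) ->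
    (forall x, f_ ^~ x @ \oo --> f x) -> K f }.

Section closed_solid_convex_theory.
Context d (T : measurableType d) (R : realType) (K : set (T -> R)).
Hypothesis hK : closed_solid_convex K.
Implicit Types f g : T -> R.

Lemma csc_min f g : K f -> measurable_fun setT g -> (forall x, 0 <= g x) ->
  K (fun x => Num.min (f x) (g x)).
Proof.
move=> Kf mg g0; apply: (csc_solid hK Kf).
  by apply: measurable_minr => //; exact: (csc_measurable hK).
by move=> x; rewrite le_min g0 (csc_ge0 hK Kf)/= ge_min lexx.
Qed.

(** The tail infima lie below [f_ n], hence in [K] by solidity, and increase to a limit kept finite
    by [g]; closure under pointwise limits then applies. *)
Lemma csc_liminf (f_ : nat -> T -> R) g : (forall n, K (f_ n)) ->
  (forall n x, f_ n x <= g x) ->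
  K (fun x => limn (infs (f_ ^~ x))) /\
  forall x, (forall n, infs (f_ ^~ x) n <= limn (infs (f_ ^~ x))) /\
    limn (infs (f_ ^~ x)) <= g x.
Proof.
move=> Kf fg.
have f0 x n : 0 <= f_ n x by exact: csc_ge0 hK _ _ _.
have f0i x n := @infs_ge0_le _ (f_ ^~ x) n (f0 x).
have cvgi x : cvgn (infs (f_ ^~ x)).
  apply/cvg_ex; eexists; apply: cvg_infs_sup.
    by exists (g x) => _ [n _ <-].
  by exists 0 => _ [n _ <-].
split.
  apply: (@csc_cvg _ _ _ _ hK (fun n x => infs (f_ ^~ x) n)) => //.
  move=> n; apply: (csc_solid hK (Kf n)) => //.
  apply: measurable_fun_infs => [x _|k]; last exact: csc_measurable hK _ _.
  by exists 0 => _ [k _ <-].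
move=> x; split.
  by apply: nondecreasing_cvgn_le => //; apply: nondecreasing_infs;
    exists 0 => _ [n _ <-].
apply: limr_le => //; apply: nearW => n.
by have /andP[_ /le_trans->] := f0i x n.
Qed.

End closed_solid_convex_theory.

Section projection.
Context d (T : measurableType d) (R : realType).
Variables (Q : probability T R) (K : set (T -> R)) (h : T -> R).
Hypothesis hK : closed_solid_convex K.
Hypothesis mh : measurable_fun setT h.
Hypothesis h01 : forall x, 0 <= h x <= 1.

(** Candidates below [h] take values in [0, 1], and the residual [h - f] is nonnegative, as a
    density must be. *)
Let S := [set f | K f /\ forall x, f x <= h x].

Let Phi f := mean Q (fun x => (h x - f x) ^+ 2).

Let S01 f : S f -> forall x, 0 <= f x <= 1.
Proof.
move=> [Kf fh] x; rewrite (csc_ge0 hK Kf)/=; apply: le_trans (fh x) _.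
by case/andP: (h01 x).
Qed.

Let bS f : S f -> bounded_mfun f.
Proof.
move=> Sf; apply: bounded_mfun_itv (S01 Sf).
by apply: (csc_measurable hK); case: Sf.
Qed.

Let bh : bounded_mfun h. Proof. exact: bounded_mfun_itv h01. Qed.

Let bhS f : S f -> bounded_mfun (fun x => h x - f x).
Proof. by move=> /bS ?; exact: bounded_mfunB. Qed.

Let S_neq0 : S !=set0.
Proof.
have [f Kf] := csc_neq0 hK; exists (fun x => Num.min (f x) (h x)); split.
  by apply: csc_min => // x; case/andP: (h01 x).
by move=> x; rewrite ge_min lexx orbT.
Qed.

Let D := inf (Phi @` S).

Let Phi_ge0 f : 0 <= Phi f.
Proof. by apply: mean_ge0 => x; exact: sqr_ge0. Qed.

Let PhiS_lb : has_lbound (Phi @` S).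
Proof. by exists 0 => _ [f _ <-]. Qed.

Let le_Phi f : S f -> D <= Phi f.
Proof. by move=> Sf; apply: ge_inf => //; exists f. Qed.

Let minimizing eps : 0 < eps -> exists2 f, S f & Phi f <= D + eps.
Proof.
move=> e0; have /(inf_adherent e0)[_ [f Sf <-] /ltW fe] : has_inf (Phi @` S).
  by split => //; have [f Sf] := S_neq0; exists (Phi f); exists f.
by exists f.
Qed.

(** By convexity the midpoint of [f] and [g] lies in [S], so its [Phi] is at least [D]; the
    parallelogram identity then forces two near-minimizers to be close in $L^2(Q)$. *)
Let parallelogram f g (e : R) : S f -> S g -> Phi f <= D + e -> Phi g <= D + e ->
  mean Q (fun x => (f x - g x) ^+ 2) <= 4 * e.
Proof.
move=> Sf Sg fe ge.
pose k x := (1 - 2^-1) * f x + 2^-1 * g x.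
have Sk : S k.
  split; first by apply: (csc_convex hK); [case: Sf|case: Sg|lra].
  by move=> x; have := Sf.2 x; have := Sg.2 x; rewrite /k; lra.
have := le_Phi Sk.
have : mean Q (fun x => (f x - g x) ^+ 2) + 4 * Phi k = 2 * Phi f + 2 * Phi g.
  have bq u : S u -> bounded_mfun (fun x => (h x - u x) ^+ 2).
    by move=> Su; exact/bounded_mfunX/bhS.
  have bfg : bounded_mfun (fun x => (f x - g x) ^+ 2).
    by apply/bounded_mfunX/bounded_mfunB; exact: bS.
  have [bqf bqg bqk] := And3 (bq _ Sf) (bq _ Sg) (bq _ Sk).
  rewrite /Phi -(meanZ Q 4 bqk) -(meanZ Q 2 bqf) -(meanZ Q 2 bqg).
  rewrite -(meanD Q bfg (bounded_mfunZ 4 bqk)).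
  rewrite -(meanD Q (bounded_mfunZ 2 bqf) (bounded_mfunZ 2 bqg)).
  by congr (mean Q _); apply/funext => x; rewrite /k; field.
lra.
Qed.

(* By solidity the limit inferior of a fast minimizing sequence is still in [K],
   and the parallelogram identity makes it a minimizer. *)
Lemma exists_projection : exists f, [/\ K f, forall x, f x <= h x &
  forall g, K g -> (forall x, g x <= h x) ->
    mean Q (fun x => (h x - f x) ^+ 2) <= mean Q (fun x => (h x - g x) ^+ 2)].
Proof.
(* An error of $4^{-n}$ puts consecutive terms within a multiple of $2^{-n}$ in $L^2(Q)$, which is
   summable. *)
have /(_ _)/cid2-/all_sig2[f_ Sf_ f_D] : forall n, exists2 f, S f & Phi f <= D + (4 ^+ n)^-1.
  by move=> n; apply: minimizing; rewrite invr_gt0 exprn_gt0.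
have [Kf finf] := @csc_liminf _ _ _ _ hK f_ h (fun n => (Sf_ n).1) (fun n => (Sf_ n).2).
set f0 := fun x => limn (infs (f_ ^~ x)) in Kf.
have Sf0 : S f0 by split => // x; exact: (finf x).2.
exists f0; split; [by []|by case: Sf0|] => g Kg gh.
suff : Phi f0 <= D by move=> /le_trans; apply; apply: le_Phi.
(* Young's inequality with weight [2 ^+ k] gives the constant $(4 + 1)/2 \le 3$. *)
have df k : mean Q (fun x => `|f_ k x - f_ k.+1 x|) <= 3 / 2 ^+ k.
  have fk := f_D k.
  have fSk : Phi (f_ k.+1) <= D + (4 ^+ k)^-1.
    apply: le_trans (f_D _) _; rewrite lerD2l lef_pV2 ?posrE ?exprn_gt0//.
    by rewrite exprS ler_peMl ?exprn_ge0// ler1n.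
  have := parallelogram (Sf_ _) (Sf_ _) fk fSk => kS.
  have p2 : 0 < 2 ^+ k :> R by rewrite exprn_gt0.
  have bu : bounded_mfun (fun x => f_ k x - f_ k.+1 x) by apply: bounded_mfunB; exact: bS.
  apply: le_trans (mean_norm_le Q bu p2) _.
  move: kS; have -> : 4 ^+ k = 2 ^+ k * 2 ^+ k :> R by rewrite -exprMn -natrM.
  set p := 2 ^+ k in p2 *; set e := mean Q _ => kS.
  have : p * e <= 4 * p^-1.
    rewrite -(ler_pM2l p2) in kS; apply: le_trans kS _.
    by rewrite le_eqVlt (_ : p * (4 * (p * p)^-1) = 4 * p^-1) ?eqxx//; field; rewrite gt_eqF.
  have : 0 < p^-1 by rewrite invr_gt0.
  lra.
apply/ler_addgt0Pr => e e0.
(* Here $13 = 1 + 2 \cdot 6$: the error $4^{-m} \le 2^{-m}$ of [f_ m], plus twice the bound $2 \cdot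
   3 / 2^m$ on its mean distance to the tail infimum. *)
have [m m13] : exists m, 13 / 2 ^+ m <= e.
  exists (Num.bound (13 / e)); rewrite ler_pdivrMr ?exprn_gt0// mulrC -ler_pdivrMr//.
  apply: le_trans (ltW (archi_boundP _)) _; first by rewrite divr_ge0// ltW.
  by rewrite -natrX ler_nat ltnW// ltn_expl.
apply: le_trans (_ : D + 13 / 2 ^+ m <= _); last by rewrite lerD2l.
have mi : measurable_fun setT (fun x => infs (f_ ^~ x) m).
  apply: measurable_fun_infs => [x _|k]; last by have [] := bS (Sf_ k).
  by exists 0 => _ [k _ <-]; case/andP: (S01 (Sf_ k) x).
have i0 x : 0 <= infs (f_ ^~ x) m <= f_ m x.
  by apply: infs_ge0_le => k; case/andP: (S01 (Sf_ k) x).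
have bi : bounded_mfun (fun x => infs (f_ ^~ x) m).
  apply: (@bounded_mfun_itv _ _ _ _ 0 1) => // x.
  by have := i0 x; have := S01 (Sf_ m) x; lra.
have bm := bS (Sf_ m).
have /(_ m) mm := mean_sub_infs_le _ (fun k => (bS (Sf_ k)).1) (fun k => S01 (Sf_ k)) df.
(* Let $i$ be the tail infimum. Since $i \le f_0 \le h$ and all values lie in [0, 1], $(h-f_0)^2 \le
   (h-i)^2 \le (h-f_m)^2 + 2(f_m-i)$. *)
apply: (@le_trans _ _ (Phi (f_ m) + 2 * mean Q (fun x => f_ m x - infs (f_ ^~ x) m))).
  rewrite -meanZ; last exact: bounded_mfunB.
  rewrite /Phi -meanD; [|exact/bounded_mfunX/bhS|exact/bounded_mfunZ/bounded_mfunB].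
  apply: le_mean; first exact/bounded_mfunX/bhS.
    apply: bounded_mfunD; first exact/bounded_mfunX/bhS.
    exact/bounded_mfunZ/bounded_mfunB.
  move=> x; have := (finf x).1 m; have := i0 x; have := S01 Sf0 x; have := Sf0.2 x.
  have := (Sf_ m).2 x; have := h01 x.
  by rewrite -/(f0 x); set i := infs _ _; nra.
have := f_D m; have -> : 4 ^+ m = 2 ^+ m * 2 ^+ m :> R by rewrite -exprMn -natrM.
have p1 : 1 <= 2 ^+ m :> R by rewrite exprn_ege1// ler1n.
have p0 : 0 <= (2 ^+ m)^-1 :> R by rewrite invr_ge0 (le_trans _ p1).
have pi : (2 ^+ m)^-1 <= 1 :> R by rewrite invf_le1 ?exprn_gt0.
by rewrite invfM; move: mm p0 pi; set q := _^-1; nra.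
Qed.

End projection.

(** * Separation of a bounded function by a bounded density *)

Section separation.
Context d (T : measurableType d) (R : realType).
Variable Q : probability T R.
Implicit Types (K : set (T -> R)) (f g h : T -> R).

(** Monotone convergence for truncations at level [n]; it carries inequalities for bounded elements
    of [K] over to unbounded ones. *)
Lemma integral_min_nat_cvg f g : measurable_fun setT f -> measurable_fun setT g ->
  (forall x, 0 <= f x) -> (forall x, 0 <= g x) ->
  ((\int[Q]_x (Num.min (f x) n%:R * g x)%:E)%E @[n --> \oo] -->
    (\int[Q]_x (f x * g x)%:E)%E).
Proof.
move=> mf mg f0 g0.
have fg x : (Num.min (f x) n%:R * g x)%:E @[n --> \oo] --> (f x * g x)%:E.
  apply: cvg_near_cst.
  exists (Num.bound (f x)) => // n /= Nn.
  rewrite min_l//; apply: le_trans (ltW (archi_boundP (f0 x))) _.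
  by rewrite ler_nat.
have -> : (\int[Q]_x (f x * g x)%:E)%E =
    (\int[Q]_x limn (fun n => (Num.min (f x) n%:R * g x)%:E))%E.
  by apply: eq_integral => x _; apply/esym/cvg_lim => //; exact: fg.
apply: cvg_monotone_convergence => //.
- move=> n; apply/measurable_EFinP; apply: measurable_funM => //.
  exact: measurable_minr.
- by move=> n x _; rewrite lee_fin mulr_ge0// le_min f0 ler0n.
- move=> x _ m n mn; rewrite lee_fin ler_wpM2r// le_min ge_min lexx/=.
  by rewrite ge_min ler_nat mn orbT.
Qed.

(* First-order condition for the minimizer along the segment from [f0] to [g];
   by solidity the points of the segment may be cut down to lie below [h]. *)
Lemma projection_ineq K h f0 g : closed_solid_convex K -> measurable_fun setT h ->
  (forall x, 0 <= h x <= 1) -> K f0 -> (forall x, f0 x <= h x) ->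
  (forall f, K f -> (forall x, f x <= h x) ->
    mean Q (fun x => (h x - f0 x) ^+ 2) <= mean Q (fun x => (h x - f x) ^+ 2)) ->
  K g -> bounded_mfun g ->
  mean Q (fun x => g x * (h x - f0 x)) <= mean Q (fun x => f0 x * (h x - f0 x)).
Proof.
move=> hK mh h01 Kf0 f0h f0min Kg bg.
have f00 := csc_ge0 hK Kf0.
have bh : bounded_mfun h by exact: bounded_mfun_itv h01.
have bf0 : bounded_mfun f0.
  apply: (@bounded_mfun_itv _ _ _ _ 0 1); first exact: csc_measurable Kf0.
  by move=> x; rewrite f00 (le_trans (f0h x))//; case/andP: (h01 x).
have bz : bounded_mfun (fun x => h x - f0 x) by exact: bounded_mfunB.
set z := fun x => h x - f0 x in bz *.
have bgz : bounded_mfun (fun x => g x * z x) by exact: bounded_mfunM.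
have bfz : bounded_mfun (fun x => f0 x * z x) by exact: bounded_mfunM.
have bgf : bounded_mfun (fun x => (g x - f0 x) ^+ 2).
  exact/bounded_mfunX/bounded_mfunB.
have bz2 : bounded_mfun (fun x => z x ^+ 2) by exact: bounded_mfunX.
set B := mean Q (fun x => (g x - f0 x) ^+ 2).
have B0 : 0 <= B by apply: mean_ge0 => x; exact: sqr_ge0.
(* [- 2 * dl] is the derivative at 0 of the squared distance to [h] along the segment from [f0] to
   [g]. *)
set dl := mean Q (fun x => g x * z x) - mean Q (fun x => f0 x * z x).
have key t : 0 < t <= 1 -> 2 * dl <= t * B.
  move=> /andP[t0 t1].
  pose V x := (1 - t) * f0 x + t * g x.
  have KV : K V by apply: (csc_convex hK) => //; rewrite (ltW t0).
  have bV : bounded_mfun V.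
    by apply: bounded_mfunD; exact: bounded_mfunZ.
  have KW : K (fun x => Num.min (V x) (h x)).
    by apply: csc_min => // x; case/andP: (h01 x).
  have W0 x : 0 <= Num.min (V x) (h x) <= 1.
    by rewrite (csc_ge0 hK KW)/= ge_min; case/andP: (h01 x) => _ ->; rewrite orbT.
  have bW := bounded_mfun_itv (csc_measurable hK KW) W0.
  have /(f0min _ KW) : forall x, Num.min (V x) (h x) <= h x.
    by move=> x; rewrite ge_min lexx orbT.
  (* Cutting the segment point down to [h] does not increase the distance: where it exceeded [h],
     the difference becomes 0. *)
  have : mean Q (fun x => (h x - Num.min (V x) (h x)) ^+ 2) <=
      mean Q (fun x => (h x - V x) ^+ 2).
    apply: le_mean; [exact/bounded_mfunX/bounded_mfunB|exact/bounded_mfunX/bounded_mfunB|].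
    by move=> x; have [hV|hV] := leP (V x) (h x); rewrite ?lexx// subrr expr0n sqr_ge0.
  move=> /[swap] /le_trans /[apply].
  have -> : (fun x => (h x - V x) ^+ 2) = (fun x => z x ^+ 2 +
      (- (2 * t) * (g x * z x - f0 x * z x) + t ^+ 2 * (g x - f0 x) ^+ 2)).
    by apply/funext => x; rewrite /V /z; ring.
  have bD := bounded_mfunB bgz bfz.
  rewrite meanD//; last first.
    by apply: bounded_mfunD; exact: bounded_mfunZ.
  rewrite lerDl meanD; [|exact: bounded_mfunZ|exact: bounded_mfunZ].
  rewrite !meanZ// meanB// -/dl -/B.
  have -> : - (2 * t) * dl + t ^+ 2 * B = t * (t * B - 2 * dl) by ring.
  by rewrite pmulr_rge0// subr_ge0.
rewrite -subr_le0 -/dl leNgt; apply/negP => dl0.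
have B1 : 0 < B + 1 + dl by lra.
(* This [t] is at most 1 and satisfies [t * B < dl], which contradicts [key]. *)
have /key : 0 < dl / (B + 1 + dl) <= 1.
  by rewrite divr_gt0//= ler_pdivrMr// mul1r; lra.
apply/negP; rewrite -ltNge mulrAC ltr_pdivrMr//; nra.
Qed.

(** With [f0] the projection of [h] and [z] the residual [h - f0], the first-order condition gives
    $E[fz] \le E[f_0 z]$ on [K], while $E[hz] = E[f_0 z] + E[z^2]$ is strictly larger; rescaling
    puts 1 in between. *)
Lemma bounded_separation K h : closed_solid_convex K -> measurable_fun setT h ->
  (forall x, 0 <= h x <= 1) ->
  (forall f, K f -> ~ {ae Q, forall x, f x = h x}) ->
  exists z : T -> R, [/\ measurable_fun setT z,
    exists M, forall x, 0 <= z x <= M,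
    forall f, K f -> (\int[Q]_x (f x * z x)%:E <= 1)%E &
    (1 < \int[Q]_x (h x * z x)%:E)%E].
Proof.
move=> hK mh h01 Kh; have [f0 [Kf0 f0h f0min]] := exists_projection Q hK mh h01.
have f00 := csc_ge0 hK Kf0.
have bh : bounded_mfun h by exact: bounded_mfun_itv h01.
have bf0 : bounded_mfun f0.
  apply: (@bounded_mfun_itv _ _ _ _ 0 1); first exact: csc_measurable Kf0.
  by move=> x; rewrite f00 (le_trans (f0h x))//; case/andP: (h01 x).
have bz : bounded_mfun (fun x => h x - f0 x) by exact: bounded_mfunB.
have pineq := projection_ineq hK mh h01 Kf0 f0h f0min.
set z := fun x => h x - f0 x in bz pineq *.
have z01 x : 0 <= z x <= 1 by have := h01 x; have := f00 x; have := f0h x; rewrite /z; lra.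
have bz2 : bounded_mfun (fun x => z x ^+ 2) by exact: bounded_mfunX.
have bfz : bounded_mfun (fun x => f0 x * z x) by exact: bounded_mfunM.
have bhz : bounded_mfun (fun x => h x * z x) by exact: bounded_mfunM.
set dl := mean Q (fun x => z x ^+ 2).
(* Otherwise [h] would agree almost surely with [f0], an element of [K]. *)
have dl0 : 0 < dl.
  rewrite lt_neqAle mean_ge0 ?andbT; last by move=> x; exact: sqr_ge0.
  apply/eqP => dl0; apply: (Kh _ Kf0).
  have : (\int[Q]_x `|(z x ^+ 2)%:E|)%E = 0%E.
    rewrite -[RHS]/(0%R%:E) dl0 EFin_mean//; apply: eq_integral => x _.
    by rewrite gee0_abs// lee_fin sqr_ge0.
  have mz2 : measurable_fun setT (fun x => (z x ^+ 2)%:E).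
    by apply/measurable_EFinP; case: bz2.
  move=> /(proj1 (ae_eq_integral_abs Q measurableT mz2)).
  by apply: filterS => x /(_ I)[/eqP]; rewrite sqrf_eq0 subr_eq0 => /eqP ->.
set al := mean Q (fun x => f0 x * z x).
have al0 : 0 <= al.
  by apply: mean_ge0 => x; rewrite mulr_ge0//; case/andP: (z01 x).
have hal : mean Q (fun x => h x * z x) = al + dl.
  by rewrite -meanD//; congr (mean Q _); apply/funext => x; rewrite /z; ring.
(* The reciprocal of [al + dl / 2], midway between the two expectations and positive even if [al] is
   0. *)
pose s := 2 / (2 * al + dl).
have s0 : 0 < s by rewrite divr_gt0//; lra.
have intZ f : measurable_fun setT f -> (forall x, 0 <= f x) ->
    (\int[Q]_x (f x * (s * z x))%:E = s%:E * \int[Q]_x (f x * z x)%:E)%E.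
  move=> mf f_0; rewrite -ge0_integralZl//.
  - by apply: eq_integral => x _; rewrite -EFinM mulrCA.
  - by apply/measurable_EFinP; apply: measurable_funM => //; case: bz.
  - by move=> x _; rewrite lee_fin mulr_ge0//; case/andP: (z01 x).
  - by rewrite lee_fin ltW.
exists (fun x => s * z x); split.
- by case: (bounded_mfunZ s bz).
- by exists s => x; have /andP[? ?] := z01 x; rewrite mulr_ge0 ?ler_piMr// ltW.
- move=> f Kf; rewrite intZ; [|exact: csc_measurable Kf|exact: csc_ge0 Kf].
  apply: (@le_trans _ _ (s%:E * al%:E)%E); last first.
    rewrite -EFinM lee_fin /s mulrAC ler_pdivrMr; lra.
  rewrite lee_wpmul2l ?lee_fin ?(ltW s0)//.
  (* [projection_ineq] asks for bounded functions: apply it to truncations of [f], which stay in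
     [K], and let the level grow. *)
  have cvgf : (\int[Q]_x (Num.min (f x) n%:R * z x)%:E)%E @[n --> \oo] -->
      (\int[Q]_x (f x * z x)%:E)%E.
    apply: integral_min_nat_cvg; [exact: csc_measurable Kf|by case: bz| |].
      exact: csc_ge0 Kf.
    by move=> x; case/andP: (z01 x).
  rewrite -(cvg_lim _ cvgf)//; apply: lime_le; first by apply/cvg_ex; eexists; exact: cvgf.
  apply: nearW => n.
  have Kfn : K (fun x => Num.min (f x) n%:R) by exact: csc_min.
  have fn x : 0 <= Num.min (f x) n%:R <= n%:R.
    by rewrite (csc_ge0 hK Kfn)/= ge_min lexx orbT.
  have bfn := bounded_mfun_itv (csc_measurable hK Kfn) fn.
  by rewrite -EFin_mean ?lee_fin; [exact: pineq|exact: bounded_mfunM].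
- rewrite intZ//; last by move=> x; case/andP: (h01 x).
  rewrite -EFin_mean// hal -EFinM lte_fin /s mulrAC ltr_pdivlMr; lra.
Qed.

End separation.

(** * Separation by a finite measure *)

Section density.
Context d (T : measurableType d) (R : realType).
Variable Q : probability T R.

(** The measure $z\,dQ$, finite because [z] is bounded. *)
Lemma exists_density (z : T -> R) (M : R) : measurable_fun setT z ->
  (forall x, 0 <= z x <= M) ->
  exists mu : {finite_measure set T -> \bar R},
    (forall N, measurable N -> Q N = 0%E -> mu N = 0%E) /\
    forall f : T -> R, measurable_fun setT f -> (forall x, 0 <= f x) ->
      (\int[mu]_x (f x)%:E = \int[Q]_x (f x * z x)%:E)%E.
Proof.
move=> mz zM; have z0 x : 0 <= z x by case/andP: (zM x).
have mEz : measurable_fun setT (EFin \o z) by exact/measurable_EFinP.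
pose m A := (\int[Q]_(x in A) (z x)%:E)%E.
have m0 : m set0 = 0%E by rewrite /m integral_set0.
have mge0 A : (0 <= m A)%E by apply: integral_ge0 => x _; rewrite lee_fin.
have madd : semi_sigma_additive m.
  by apply: semi_sigma_additive_nng_induced => // x; rewrite lee_fin.
pose m1 := isMeasure.Build _ _ _ m m0 mge0 madd.
pose mu1 : {measure set T -> \bar R} := HB.pack m m1.
have bz : bounded_mfun z by exact: bounded_mfun_itv zM.
have mfin : fin_num_fun mu1.
  by apply: lty_fin_num_fun; rewrite -[mu1 _]/(m _) /m -EFin_mean ?ltry.
pose m2 := Measure_isFinite.Build _ _ _ mu1 mfin.
pose mu : {finite_measure set T -> \bar R} := HB.pack (Measure.sort mu1) m2.
have muQ : mu `<< Q.
  apply/null_content_dominatesP => A mA QA.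
  by apply: null_set_integral => //; exact: measurable_funTS.
exists mu; split => [N mN QN|f mf f0].
  by move/null_content_dominatesP : muQ; apply.
have mEf : measurable_fun setT (EFin \o f) by exact/measurable_EFinP.
have Ef0 x : (0 <= (EFin \o f) x)%E by rewrite lee_fin.
rewrite -(Radon_Nikodym_SigmaFinite.change_of_variables muQ Ef0 measurableT mEf).
set rn := Radon_Nikodym_SigmaFinite.f mu Q.
have irn : Q.-integrable setT rn by exact: Radon_Nikodym_SigmaFinite.f_integrable.
(* The change of variables is expressed through the derivative [rn]; [z] has the same integrals over
   measurable sets, so the two agree almost surely. *)
have zrn : ae_eq Q setT (EFin \o z) rn.
  apply: integral_ae_eq => //; first exact: bounded_mfun_integrable.
    exact: measurable_int irn.
  by move=> A _ mA; rewrite -Radon_Nikodym_SigmaFinite.f_integral.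
apply: ae_eq_integral => //.
- apply: emeasurable_funM; first exact/measurable_EFinP.
  exact: measurable_int irn.
- by apply/measurable_EFinP; exact: measurable_funM.
- by apply: filterS zrn => x /(_ I) /= <- _; rewrite EFinM.
Qed.

End density.

Section unbounded_separation.
Context d (T : measurableType d) (R : realType).
Variables (Q : probability T R) (K : set (T -> R)).
Hypothesis hK : closed_solid_convex K.

(* Multiplication by $e^{-g}$ turns [g] into a function with values in [0, 1],
   since $x e^{-x} \le 1$. *)
Lemma closed_solid_convex_expR (g : T -> R) : measurable_fun setT g ->
  closed_solid_convex [set f : T -> R | K (fun x => f x * expR (g x))].
Proof.
move=> mg.
have me : measurable_fun setT (fun x => expR (g x)) by exact: measurableT_comp.
have meN : measurable_fun setT (fun x => expR (- g x)).
  by apply: measurableT_comp => //; exact: measurableT_comp.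
have eK (f : T -> R) : (fun x => f x * expR (- g x) * expR (g x)) = f.
  by apply/funext => x; rewrite -mulrA [_ * expR (g x)]mulrC expRxMexpNx_1 mulr1.
have eNK (f : T -> R) : (fun x => f x * expR (g x) * expR (- g x)) = f.
  by apply/funext => x; rewrite -mulrA expRxMexpNx_1 mulr1.
split.
- by have [k Kk] := csc_neq0 hK; exists (fun x => k x * expR (- g x)); rewrite /= eK.
- move=> f /= Kf; rewrite -(eNK f); apply: measurable_funM => //.
  exact: csc_measurable Kf.
- by move=> f /= /(csc_ge0 hK) f0 x; rewrite -(pmulr_lge0 _ (expR_gt0 (g x))).
- move=> f k /= Kf mk kf; apply: (csc_solid hK Kf); first exact: measurable_funM.
  move=> x; have /andP[k0 kfx] := kf x.
  by rewrite mulr_ge0 ?expR_ge0//= ler_wpM2r ?expR_ge0.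
- move=> f k t /= Kf Kk t01; have := csc_convex hK Kf Kk t01.
  by congr K; apply/funext => x; ring.
- move=> f_ f /= Kf_ f_f; apply: (csc_cvg hK Kf_) => x.
  by apply: cvgM; [exact: f_f|exact: cvg_cst].
Qed.

(** The density [z] found for $h = g e^{-g}$ and the rescaled set becomes $e^{-g} z$ for [g] and
    [K], still bounded since $g \ge 0$. *)
Lemma separation (g : T -> R) : measurable_fun setT g -> (forall x, 0 <= g x) ->
  (forall f, K f -> ~ {ae Q, forall x, f x = g x}) ->
  exists mu : {finite_measure set T -> \bar R},
    [/\ forall N, measurable N -> Q N = 0%E -> mu N = 0%E,
      forall f, K f -> (\int[mu]_x (f x)%:E <= 1)%E &
      (1 < \int[mu]_x (g x)%:E)%E].
Proof.
move=> mg g0 Kg.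
have me : measurable_fun setT (fun x => expR (g x)) by exact: measurableT_comp.
have meN : measurable_fun setT (fun x => expR (- g x)).
  by apply: measurableT_comp => //; exact: measurableT_comp.
pose h x := g x * expR (- g x).
have mh : measurable_fun setT h by exact: measurable_funM.
have h01 x : 0 <= h x <= 1.
  rewrite mulr_ge0 ?expR_ge0//= /h expRN ler_pdivrMr ?expR_gt0// mul1r.
  by apply: le_trans (expR_ge1Dx _); rewrite lerDr.
have [|z [mz [M zM] Kz hz]] := bounded_separation (Q := Q) (closed_solid_convex_expR mg) mh h01.
  move=> f Kf fh; apply: (Kg _ Kf); apply: filterS fh => x ->.
  by rewrite /h -mulrA [_ * expR (g x)]mulrC expRxMexpNx_1 mulr1.
have [|x|mu [muQ muE]] := @exists_density _ _ _ Q (fun x => expR (- g x) * z x) M.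
- exact: measurable_funM.
- have /andP[z0 zMx] := zM x; rewrite mulr_ge0 ?expR_ge0//=.
  by apply: le_trans zMx; rewrite ler_piMl// -expR0 ler_expR oppr_le0.
exists mu; split => //.
- move=> f Kf; rewrite muE; [|exact: csc_measurable Kf|exact: csc_ge0 Kf].
  under eq_integral do rewrite mulrA.
  apply: Kz; rewrite /= (_ : (fun x => _) = f)//; apply/funext => x.
  by rewrite -mulrA [_ * expR (g x)]mulrC expRxMexpNx_1 mulr1.
- rewrite muE//; move: hz; congr (_ < _)%E.
  by apply: eq_integral => x _; rewrite /h mulrA.
Qed.

End unbounded_separation.

(** * Bipolar theorem *)

Section quasi_sure_theory.
Context d (T : measurableType d) (R : realType) (P : set (probability T R)).
Implicit Types (X Y : L0 P).

(** By countable subadditivity under each measure of [P], the union of the exceptional sets is again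
    polar. *)
Lemma qs_forall (A : nat -> set T) : (forall n, qs P (A n)) ->
  qs P [set w | forall n, A n w].
Proof.
move=> PA; have /all_sig2[N pN NA] : forall n, {N | polar P N & ~` N `<=` A n}.
  by move=> n; apply/cid2; exact: PA.
exists (\bigcup_n N n); last first.
  by rewrite setC_bigcup => w Nw n; apply: NA; exact: Nw.
apply/polarE; split; first by apply: bigcup_measurable => n _; case: (pN n).
move=> Q PQ; apply: measure_negligible.
  by apply: bigcup_measurable => n _; case: (pN n).
apply: negligible_bigcup => n; have /polarE[mN N0] := pN n.
by apply/negligibleP => //; exact: N0.
Qed.

Lemma qs_prob_c Q : P Q -> prob_c P Q.
Proof. by move=> PQ N /polarE[_]; exact. Qed.

Lemma qs_ae (mu : {finite_measure set T -> \bar R}) (A : set T) :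
  ca_c_pos P mu -> qs P A -> {ae mu, forall w, A w}.
Proof.
move=> muP [N pN NA]; exists N; split; [by case: pN|exact: muP|].
by move=> w /=; apply: contra_notP => /NA.
Qed.

(** The complement of [A], being measurable, is itself an exceptional set common to all of [P],
    whereas the null sets given for each [Q] may vary with [Q]. *)
Lemma qs_null (A : set T) : measurable (~` A) ->
  (forall Q, P Q -> {ae Q, forall w, A w}) -> qs P A.
Proof.
move=> mA QA; exists (~` A); last by rewrite setCK.
by apply/polarE; split => // Q PQ; apply: measure_negligible => //; exact: QA.
Qed.

Lemma L0_leP X Y : X <= Y <-> \forall w \near qs P, X w <= Y w.
Proof. by split => [/asboolP|XY] //; apply/asboolP. Qed.

Lemma L0_0E : \forall w \near qs P, (0 : L0 P) w = 0.
Proof. exact: L0_classE P (0 : {mfun T >-> R}). Qed.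

Lemma L0_ge0P X : 0 <= X <-> \forall w \near qs P, 0 <= X w.
Proof.
by rewrite L0_leP; split; apply: filterS2 L0_0E => w ->.
Qed.

Lemma L0_DE X Y : \forall w \near qs P, (X + Y : L0 P) w = X w + Y w.
Proof.
by have := L0_classE P ((X : {mfun T >-> R}) + Y); rewrite L0_classD !L0_classK.
Qed.

Lemma L0_NE X : \forall w \near qs P, (- X : L0 P) w = - X w.
Proof.
by have := L0_classE P (- (X : {mfun T >-> R})); rewrite L0_classN !L0_classK.
Qed.

Lemma L0_ZE (a : R) X : \forall w \near qs P, (a *: X : L0 P) w = a * X w.
Proof.
by have := L0_classE P (a *: (X : {mfun T >-> R})); rewrite L0_classZ !L0_classK.
Qed.

Lemma L0_abs_subE X Y : \forall w \near qs P, L0_abs (X - Y) w = `|X w - Y w|.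
Proof.
have := L0_classE P (@Num.norm R R \o (X - Y : L0 P) : {mfun T >-> R}).
rewrite -L0_abs_class L0_classK.
by apply: filterS3 (L0_DE X (- Y)) (L0_NE Y) => w DE NE -> /=; rewrite DE NE.
Qed.

Lemma L0_ex (f : T -> R) : measurable_fun setT f ->
  exists X : L0 P, \forall w \near qs P, X w = f w.
Proof.
move=> mf; pose m1 := isMeasurableFun.Build _ _ _ _ f mf.
pose F : {mfun T >-> R} := HB.pack f m1.
by exists (L0_class P F); exact: L0_classE P F.
Qed.

Lemma measurable_L0 X : measurable_fun setT (X : T -> R).
Proof. exact: measurable_funP. Qed.

Lemma L0_integralE (mu : {finite_measure set T -> \bar R}) X (f : T -> R) :
  ca_c_pos P mu -> measurable_fun setT f ->
  (\forall w \near qs P, X w = f w) ->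
  L0_integral mu X = (\int[mu]_w (f w)%:E)%E.
Proof.
move=> muP mf Xf; apply: ae_eq_integral => //.
- exact/measurable_EFinP/measurable_L0.
- exact/measurable_EFinP.
- by apply: filterS (qs_ae muP Xf) => w /= -> _.
Qed.

Lemma L0_integral_max (mu : {finite_measure set T -> \bar R}) X :
  ca_c_pos P mu -> 0 <= X ->
  L0_integral mu X = (\int[mu]_w (Num.max (X w) 0)%:E)%E.
Proof.
move=> muP /L0_ge0P X0; apply: L0_integralE => //.
  by apply: measurable_maxr => //; exact: measurable_L0.
by apply: filterS X0 => w Xw; rewrite max_l.
Qed.

Lemma L0_proj_eqP Q X Y :
  L0_proj Q X = L0_proj Q Y <-> {ae Q, forall w, X w = Y w}.
Proof.
split => [/eqP|XY].
  by rewrite eqmodE => /asboolP; apply: filterS => w /(_ I).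
by apply/eqP; rewrite eqmodE; apply/asboolP; apply: filterS XY => w.
Qed.

(** Working form, in which the [X] matching [Y] may change with [Q]. The other inclusion of the
    definition is trivial. *)
Lemma sensitiveP (C : set (L0 P)) : sensitive C <->
  forall Y, (forall Q, prob_c P Q ->
    exists2 X, C X & {ae Q, forall w, X w = Y w}) -> C Y.
Proof.
split => [sC Y YC|CY].
  rewrite sC => Q PQ; have [X CX /L0_proj_eqP XY] := YC Q PQ.
  by exists X.
apply/seteqP; split => [X CX Q _|Y YC]; first by exists X.
by apply: CY => Q /YC[X CX /L0_proj_eqP XY]; exists X.
Qed.

End quasi_sure_theory.

(** * Order convergence and quasi-sure convergence *)

Section order_convergence.
Context d (T : measurableType d) (R : realType) (P : set (probability T R)).
Implicit Types (X Y : L0 P).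

(* The dominating sequence is $\sup_{m\ge n} |f_m - f|$, which is real-valued
   because the convergence is pointwise everywhere. *)
Lemma cvg_order_cvg (f_ : nat -> T -> R) (f : T -> R) (X_ : nat -> L0 P) X :
  (forall n, measurable_fun setT (f_ n)) -> measurable_fun setT f ->
  (forall w, f_ ^~ w @ \oo --> f w) ->
  (forall n, \forall w \near qs P, X_ n w = f_ n w) ->
  (\forall w \near qs P, X w = f w) ->
  order_cvg X_ X.
Proof.
move=> mf_ mf f_f X_f Xf.
pose u w n := `|f_ n w - f w|.
have cu w : u w @ \oo --> 0.
  apply/cvgrPdist_le => e e0; have /cvgrPdist_le/(_ e e0) := f_f w.
  by apply: filterS => n; rewrite sub0r normrN normr_id distrC.
have ub w : has_ubound (range (u w)).
  by apply/bounded_fun_has_ubound/cvg_seq_bounded/cvg_ex; exists 0; exact: cu.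
have mY n : measurable_fun setT (fun w => sups (u w) n).
  apply: (@measurable_fun_sups _ _ _ _ (fun n w => u w n)) => // m.
  by apply: measurableT_comp => //; exact: measurable_funB.
have /choice[Y_ YE] : forall n, exists Y : L0 P, \forall w \near qs P, Y w = sups (u w) n.
  by move=> n; exact: L0_ex.
have {}YE := qs_forall YE.
exists Y_; split.
- move=> m n mn; apply/L0_leP; apply: filterS YE => w YE; rewrite !YE.
  exact: nonincreasing_sups.
- split.
    move=> _ [n _ <-]; apply/L0_ge0P; apply: filterS YE => w ->.
    apply: le_trans (normr_ge0 (f_ n w - f w)) _; apply: ub_le_sup.
      exact: has_ubound_sdrop.
    by exists n => /=.
  move=> V VY; apply/L0_leP.
  have : \forall w \near qs P, forall n, (V : L0 P) w <= Y_ n w.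
    by apply: qs_forall => n; apply/L0_leP; apply: VY; exists n.
  apply: filterS3 YE (@L0_0E _ _ _ P) => w YE -> VYw.
  have cs := cvg_sups (cu w).
  rewrite -(cvg_lim (@norm_hausdorff _ R) cs); apply: limr_ge.
    by apply/cvg_ex; exists 0; exact: cs.
  by apply: nearW => n; rewrite -YE.
- move=> n; apply/L0_leP.
  apply: filterS3 YE (L0_abs_subE (X_ n) X) (filterI (X_f n) Xf) => w YE -> [-> ->].
  by rewrite YE; apply: ub_le_sup; [exact: has_ubound_sdrop|exists n => /=].
Qed.

(* The pointwise infimum of the dominating sequence is measurable, so its class is
   a lower bound and hence vanishes quasi-surely. *)
Lemma order_cvg_cvg (X_ : nat -> L0 P) X : order_cvg X_ X ->
  \forall w \near qs P, X_ ^~ w @ \oo --> X w.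
Proof.
move=> [Y_ [Ynd [Y0 Yinf] XY]].
have Yge0 n : 0 <= Y_ n by apply: Y0; exists n.
pose u w n := Num.max (Y_ n w) 0.
have u0 w : has_lbound (range (u w)).
  by exists 0 => _ [n _ <-]; rewrite le_max lexx orbT.
have [G GE] : exists G : L0 P, \forall w \near qs P, G w = infs (u w) 0%N.
  apply: L0_ex; apply: (@measurable_fun_infs _ _ _ _ (fun n w => u w n)) => // n.
  by apply: measurable_maxr => //; exact: measurable_L0.
have qY0 : \forall w \near qs P, forall n, 0 <= Y_ n w.
  by apply: qs_forall => n; exact/L0_ge0P.
have /L0_leP G0 : G <= 0.
  apply: Yinf => _ [n _ <-]; apply/L0_leP; apply: filterS2 GE qY0 => w -> Yw.
  have <- : u w n = Y_ n w by rewrite /u max_l.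
  by apply: ge_inf; [exact: has_lbound_sdrop|exists n].
have qYnd : \forall w \near qs P, forall n, Y_ n.+1 w <= Y_ n w.
  by apply: qs_forall => n; apply/L0_leP; exact: Ynd.
have qXY : \forall w \near qs P, forall n, `|X_ n w - X w| <= Y_ n w.
  apply: qs_forall => n; move: (XY n) => /L0_leP.
  by apply: filterS2 (L0_abs_subE (X_ n) X) => w ->.
have qG : \forall w \near qs P, infs (u w) 0%N <= 0.
  by apply: filterS3 GE G0 (@L0_0E _ _ _ P) => w -> Gw zw; rewrite zw in Gw.
apply: filterS3 qG qXY (filterI qY0 qYnd) => w Gw XYw [Yw Ynw].
apply/cvgrPdist_le => e e0.
have une : sdrop (u w) 0%N !=set0 by exists (u w 0%N); exists 0%N.
have /(inf_lt une)[_ [n _ <-]] : inf (sdrop (u w) 0%N) < e by exact: le_lt_trans e0.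
rewrite /u max_l// => Yne; exists n => // m /= nm.
rewrite distrC; apply: le_trans (XYw m) _; apply: le_trans (ltW Yne).
by move/nonincreasing_seqP : Ynw; apply.
Qed.

End order_convergence.

(** * Bipolar theorem for classes; sensitivity and closedness of sets given by integral bounds *)

Section bipolar.
Context d (T : measurableType d) (R : realType) (P : set (probability T R)).
Implicit Types (X Y : L0 P) (C : set (L0 P)).

Definition nneg_representatives C : set (T -> R) :=
  [set f : T -> R | [/\ measurable_fun setT f, forall w, 0 <= f w &
    exists2 X, C X & \forall w \near qs P, X w = f w]].

Lemma nneg_representatives_max C X : C X -> 0 <= X ->
  nneg_representatives C (fun w => Num.max (X w) 0).
Proof.
move=> CX /L0_ge0P X0; split.
- by apply: measurable_maxr => //; exact: measurable_L0.
- by move=> w; rewrite le_max lexx orbT.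
- by exists X => //; apply: filterS X0 => w Xw; rewrite max_l.
Qed.

(** Order closedness enters in the clause on limits: pointwise convergence of representatives
    implies order convergence of their classes. *)
Lemma closed_solid_convex_representatives C : C !=set0 -> C `<=` L0_pos P ->
  (forall X Y (t : R), C X -> C Y -> 0 <= t <= 1 -> C ((1 - t) *: X + t *: Y)) ->
  solid C -> seq_order_closed C ->
  closed_solid_convex (nneg_representatives C).
Proof.
move=> [X0 CX0] C0 Cconv Csolid Cclosed; split.
- by exists (fun w => Num.max (X0 w) 0); apply: nneg_representatives_max => //; exact: C0.
- by move=> f [].
- by move=> f [].
- move=> f g [mf f0 [X CX Xf]] mg gf; split => //.
    by move=> w; case/andP: (gf w).
  have [Y Yg] := L0_ex P mg; exists Y => //; apply: Csolid CX _ _.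
    by apply/L0_ge0P; apply: filterS Yg => w ->; case/andP: (gf w).
  by apply/L0_leP; apply: filterS2 Xf Yg => w -> ->; case/andP: (gf w).
- move=> f g t [mf f0 [X CX Xf]] [mg g0 [Y CY Yg]] t01; split.
  + by apply: measurable_funD; exact: measurable_funM.
  + by move=> w; have /andP[? ?] := t01; rewrite addr_ge0// mulr_ge0// subr_ge0.
  + exists ((1 - t) *: X + t *: Y); first exact: Cconv.
    apply: filterS3 (filterI Xf Yg) (L0_DE ((1 - t) *: X) (t *: Y))
      (filterI (L0_ZE (1 - t) X) (L0_ZE t Y)) => w [Xw Yw] DE [Z1 Z2].
    by rewrite DE Z1 Z2 Xw Yw.
- move=> f_ f Kf f_f.
  have mf_ n : measurable_fun setT (f_ n) by case: (Kf n).
  have mf : measurable_fun setT f.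
    by apply: (measurable_fun_cvg mf_) => w _; exact: f_f.
  split => //.
    move=> w; rewrite -(cvg_lim (@norm_hausdorff _ R) (f_f w)); apply: limr_ge.
      by apply/cvg_ex; exists (f w); exact: f_f.
    by apply: nearW => n; case: (Kf n).
  have /choice[X_ X_f] : forall n, exists X, C X /\ \forall w \near qs P, X w = f_ n w.
    by move=> n; have [_ _ [X]] := Kf n; exists X.
  have [X Xf] := L0_ex P mf; exists X => //.
  apply: (Cclosed X_) => [n|]; first by case: (X_f n).
  by apply: (@cvg_order_cvg _ _ _ _ f_ f) => // n; case: (X_f n).
Qed.

(** If [Y] lay outside [C], sensitivity would give a [Q] under which no element of [C] equals [Y]
    almost surely; the separating measure lies in the polar of [C] and contradicts the choice of
    [Y]. *)
Lemma bipolar_sub C : C !=set0 -> C `<=` L0_pos P ->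
  (forall X Y (t : R), C X -> C Y -> 0 <= t <= 1 -> C ((1 - t) *: X + t *: Y)) ->
  solid C -> sensitive C -> seq_order_closed C ->
  ca_bipolar C `<=` C.
Proof.
move=> Cn0 C0 Cconv Csolid /sensitiveP Csens Cclosed Y [Y0 YC].
apply: Csens => Q QP; apply: contrapT => noX.
have hK := closed_solid_convex_representatives Cn0 C0 Cconv Csolid Cclosed.
pose g w := Num.max (Y w) 0.
have mg : measurable_fun setT g.
  by apply: measurable_maxr => //; exact: measurable_L0.
have g0 w : 0 <= g w by rewrite le_max lexx orbT.
have Yg : \forall w \near qs P, Y w = g w.
  by move/L0_ge0P : Y0; apply: filterS => w Yw; rewrite /g max_l.
have [|mu [muQ muC]] := separation (Q := Q) hK mg g0.
  move=> f [mf f0 [X CX Xf]] fg; apply: noX; exists X => //.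
  by apply: filterS3 fg (qs_ae QP Xf) (qs_ae QP Yg) => w + -> ->.
(* Polar events are [Q]-null, and [mu] vanishes on the null sets of [Q]. *)
have muP : ca_c_pos P mu by move=> N pN; apply: muQ; [case: pN|exact: QP].
rewrite -(L0_integral_max muP Y0) ltNge => /negP; apply; apply: YC; split => // X CX.
rewrite L0_integral_max//; last exact: C0.
by apply: muC; apply: nneg_representatives_max => //; exact: C0.
Qed.

(** Sensitivity speaks of probabilities, polars of finite measures; normalising links them without
    changing the null sets. *)
Lemma exists_normalization (mu : {finite_measure set T -> \bar R}) :
  mu setT != 0%E -> exists Q : probability T R,
    forall N, measurable N -> Q N = 0%E <-> mu N = 0%E.
Proof.
move=> mu0; have [t _] : [set: T] !=set0.
  by apply/set0P; apply: contra mu0 => /eqP ->; rewrite measure0.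
(* The Dirac mass is the default of [mnormalize] for total mass 0 or infinity, both excluded
   here. *)
exists (mnormalize mu (\d_t : probability T R)) => N mN.
have mufin : mu setT \is a fin_num by exact: fin_num_measure.
have muoo : (mu setT == +oo%E) = false by case: (mu setT) mufin.
rewrite /= /mnormalize (negbTE mu0) muoo/=.
split => [/eqP|->]; last by rewrite mul0e.
by rewrite mule_eq0 eqe invr_eq0 fine_eq0// (negbTE mu0) orbF => /eqP.
Qed.

Section integral_le1.
Variable M : set {finite_measure set T -> \bar R}.
Hypothesis MP : M `<=` ca_c_pos P.
Let D := [set Y : L0 P | 0 <= Y /\ forall mu, M mu -> (L0_integral mu Y <= 1)%E].

(** Each constraint is checked under its own probability: positivity under every member of [P], the
    bound for [mu] under the normalisation of [mu]. *)
Lemma integral_le1_sensitive : sensitive D.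
Proof.
apply/sensitiveP => Y YD.
have mY0 : measurable (~` [set w | 0 <= Y w]).
  apply: measurableC; rewrite -[X in measurable X]setTI.
  by apply: (measurable_fun_le (f := fun=> 0)) => //; exact: measurable_L0.
split.
  apply/L0_ge0P; apply: qs_null => // Q PQ.
  have [X [/L0_ge0P X0 _] XY] := YD Q (qs_prob_c PQ).
  by apply: filterS2 XY (qs_ae (qs_prob_c PQ) X0) => w ->.
(* The zero measure cannot be normalised, but it integrates everything to 0. *)
move=> mu Mmu; have [mu0|mu0] := eqVneq (mu setT) 0%E.
  rewrite /L0_integral null_set_integral//.
  by apply/measurable_EFinP/measurable_L0.
have [Q Qmu] := exists_normalization mu0.
have [N pN|X [_ XM] XY] := YD Q.
  by apply/Qmu; [case: pN|exact: MP].
rewrite -[L0_integral mu Y](_ : L0_integral mu X = _); first exact: XM.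
apply: ae_eq_integral => //; try exact/measurable_EFinP/measurable_L0.
have [N [mN QN NXY]] := XY; exists N; split => //; first exact/Qmu.
by apply: subset_trans NXY => w /= h XYw; apply: h => _; rewrite XYw.
Qed.

(** Order convergence gives quasi-sure convergence; Fatou's lemma is then applied off a [mu]-null
    set. *)
Lemma integral_le1_seq_order_closed : seq_order_closed D.
Proof.
move=> X_ X DX /order_cvg_cvg X_X.
have X_0 : \forall w \near qs P, forall n, 0 <= X_ n w.
  by apply: qs_forall => n; apply/L0_ge0P; case: (DX n).
have X0 : 0 <= X.
  apply/L0_ge0P; apply: filterS2 X_X X_0 => w X_X Xw0.
  rewrite -(cvg_lim (@norm_hausdorff _ R) X_X); apply: limr_ge.
    by apply/cvg_ex; exists (X w); exact: X_X.
  exact: nearW.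
split => // mu Mmu; have muP := MP Mmu.
have [N [mN muN Ncvg]] := qs_ae muP (filterI X_X X_0).
pose f n w := (Num.max (X_ n w) 0)%:E.
have mf n : measurable_fun setT (f n).
  by apply/measurable_EFinP/measurable_maxr => //; exact: measurable_L0.
have f0 n w : (0 <= f n w)%E by rewrite lee_fin le_max lexx orbT.
have mX : measurable_fun setT (fun w => (Num.max (X w) 0)%:E).
  by apply/measurable_EFinP/measurable_maxr => //; exact: measurable_L0.
have muf n : (\int[mu]_(w in ~` N) f n w <= 1)%E.
  have := (DX n).2 _ Mmu; rewrite L0_integral_max//; last by case: (DX n).
  by apply: le_trans; apply: ge0_subset_integral => //; exact: measurableC.
have mX0 w : setT w -> (0 <= (Num.max (X w) 0)%:E)%E by rewrite lee_fin le_max lexx orbT.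
rewrite L0_integral_max// (ge0_negligible_integral mN measurableT mX mX0 muN) setTD.
apply: (@le_trans _ _ (limn_einf (fun n => \int[mu]_(w in ~` N) f n w)%E)).
  rewrite (eq_integral (fun w => limn_einf (f ^~ w))).
    by apply: fatou => //; [exact: measurableC|move=> n; exact: measurable_funTS].
  move=> w; rewrite inE => Nw; apply/esym.
  have [Xw Xw0] : (X_ ^~ w @ \oo --> X w) /\ forall n, 0 <= X_ n w.
    by apply: contrapT => h; apply: Nw; exact: Ncvg.
  have Xge0 : 0 <= X w.
    rewrite -(cvg_lim (@norm_hausdorff _ R) Xw); apply: limr_ge; last exact: nearW.
    by apply/cvg_ex; exists (X w).
  apply: (@cvg_limn_einf_sup _ (f ^~ w) (Num.max (X w) 0)%:E _).1.
  rewrite max_l// /f; under eq_fun do rewrite max_l//.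
  by apply: cvg_EFin; [exact: nearW|exact: Xw].
rewrite limn_einf_lim; apply: lime_le; first exact: is_cvg_einfs.
apply: nearW => n; apply: le_trans (muf n); apply: ereal_inf_lbound.
by exists n => /=.
Qed.
End integral_le1.
End bipolar.

(** * Marginals and hedging *)

Section image_measure.
Context d d' (T : measurableType d) (T' : measurableType d') (R : realType).
Variables (phi : T -> T') (mphi : measurable_fun setT phi).
Implicit Types (mu : {finite_measure set T -> \bar R})
  (nu : {finite_measure set T' -> \bar R}).

Lemma exists_image_measure mu : exists nu, forall A, nu A = mu (phi @^-1` A).
Proof.
pose nu0 : {measure set T' -> \bar R} := pushforward mu phi.
pose nu1 := nu0 mphi.
have nufin : fin_num_fun nu1.
  move=> A mA; apply: fin_num_measure.
  by rewrite -[X in measurable X]setTI; exact: mphi.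
pose m2 := Measure_isFinite.Build _ _ _ nu1 nufin.
pose nu : {finite_measure set T' -> \bar R} := HB.pack (Measure.sort nu1) m2.
by exists nu.
Qed.

Lemma integral_image_measure mu nu (f : T' -> R) :
  (forall A, measurable A -> mu (phi @^-1` A) = nu A) ->
  measurable_fun setT f -> (forall x, 0 <= f x) ->
  (\int[nu]_x (f x)%:E = \int[mu]_x (f (phi x))%:E)%E.
Proof.
move=> munu mf f0.
transitivity (\int[pushforward mu phi]_x (f x)%:E)%E.
  by apply: eq_measure_integral => A mA _; exact/esym/munu.
rewrite ge0_integral_pushforward//; first exact/measurable_EFinP.
by move=> y _; rewrite lee_fin.
Qed.

Variables (P : set (probability T R)) (P' : set (probability T' R)).
Hypothesis polar_phi : forall N, polar P' N -> polar P (phi @^-1` N).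

Lemma qs_preimage (A : set T') : qs P' A -> qs P (phi @^-1` A).
Proof.
move=> [N pN NA]; exists (phi @^-1` N); first exact: polar_phi.
by move=> w Nw; apply: NA.
Qed.

Lemma ca_c_pos_image mu nu : (forall A, measurable A -> mu (phi @^-1` A) = nu A) ->
  ca_c_pos P mu -> ca_c_pos P' nu.
Proof.
move=> munu muP N pN; rewrite -munu; last by case: pN.
exact/muP/polar_phi.
Qed.

End image_measure.

(** * Lifting quasi-sure statements and integrals from the marginals *)

Section marginals.
Context d1 d2 (T1 : measurableType d1) (T2 : measurableType d2) (R : realType).
Variables (P1 : set (probability T1 R)) (P2 : set (probability T2 R)).
Local Notation P := (couplings P1 P2).

Lemma fst_marginalE (mu : set (T1 * T2) -> \bar R) A :
  fst_marginal mu A = mu (fst @^-1` A).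
Proof.
by congr (mu _); apply/seteqP; split => [[x y] []|[x y] Ax].
Qed.

Lemma snd_marginalE (mu : set (T1 * T2) -> \bar R) A :
  snd_marginal mu A = mu (snd @^-1` A).
Proof.
by congr (mu _); apply/seteqP; split => [[x y] []|[x y] Ax].
Qed.

(** Every coupling has its first marginal in [P1], so it gives the cylinder over [N] probability
    0. *)
Lemma polar_fst N : polar P1 N -> polar P (fst @^-1` N).
Proof.
move=> /polarE[mN N0]; apply/polarE; split.
  by rewrite -[X in measurable X]setTI; exact: measurable_fst.
by move=> Q [[Q1 PQ1 QE] _]; rewrite -fst_marginalE QE// N0.
Qed.

Lemma polar_snd N : polar P2 N -> polar P (snd @^-1` N).
Proof.
move=> /polarE[mN N0]; apply/polarE; split.
  by rewrite -[X in measurable X]setTI; exact: measurable_snd.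
by move=> Q [_ [Q2 PQ2 QE]]; rewrite -snd_marginalE QE// N0.
Qed.

Lemma oplusE (Y1 : L0 P1) (Y2 : L0 P2) :
  \forall w \near qs P, oplus Y1 Y2 w = Y1 w.1 + Y2 w.2.
Proof. exact: L0_classE. Qed.

Lemma oplus_ge0 (Y1 : L0 P1) (Y2 : L0 P2) : 0 <= Y1 -> 0 <= Y2 -> 0 <= oplus Y1 Y2.
Proof.
move=> /L0_ge0P Y10 /L0_ge0P Y20; apply/L0_ge0P.
apply: filterS3 (oplusE Y1 Y2) (qs_preimage polar_fst Y10)
  (qs_preimage polar_snd Y20) => w -> /= ? ?.
exact: addr_ge0.
Qed.

(** Linearity and change of variables along the two projections: only the marginals of [mu]
    matter. *)
Lemma L0_integral_oplus (mu : {finite_measure set (T1 * T2)%type -> \bar R})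
    (mu1 : {finite_measure set T1 -> \bar R}) (mu2 : {finite_measure set T2 -> \bar R})
    (Y1 : L0 P1) (Y2 : L0 P2) :
  ca_c_pos P mu ->
  eq_measurable (fst_marginal mu) mu1 -> eq_measurable (snd_marginal mu) mu2 ->
  0 <= Y1 -> 0 <= Y2 ->
  (L0_integral mu (oplus Y1 Y2) = L0_integral mu1 Y1 + L0_integral mu2 Y2)%E.
Proof.
move=> muP mu1E mu2E Y10 Y20.
have {}mu1E A : measurable A -> mu (fst @^-1` A) = mu1 A.
  by move=> /mu1E; rewrite fst_marginalE.
have {}mu2E A : measurable A -> mu (snd @^-1` A) = mu2 A.
  by move=> /mu2E; rewrite snd_marginalE.
rewrite [in RHS]L0_integral_max//; last first.
  exact: ca_c_pos_image polar_fst _ _ mu1E muP.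
rewrite [in RHS]L0_integral_max//; last first.
  exact: ca_c_pos_image polar_snd _ _ mu2E muP.
have m1 : measurable_fun setT (fun w => Num.max (Y1 w) 0).
  by apply: measurable_maxr => //; exact: measurable_L0.
have m2 : measurable_fun setT (fun w => Num.max (Y2 w) 0).
  by apply: measurable_maxr => //; exact: measurable_L0.
have max0 (r : R) : 0 <= Num.max r 0 by rewrite le_max lexx orbT.
rewrite (integral_image_measure measurable_fst mu1E)//.
rewrite (integral_image_measure measurable_snd mu2E)//.
have m1f : measurable_fun setT (fun w : T1 * T2 => Num.max (Y1 w.1) 0).
  exact: (measurableT_comp m1 measurable_fst).
have m2s : measurable_fun setT (fun w : T1 * T2 => Num.max (Y2 w.2) 0).
  exact: (measurableT_comp m2 measurable_snd).
rewrite -ge0_integralD//; try exact/measurable_EFinP; try by move=> *; rewrite lee_fin.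
apply: L0_integralE => //; first exact: measurable_funD.
move/L0_ge0P : Y10 => Y10; move/L0_ge0P : Y20 => Y20.
apply: filterS3 (oplusE Y1 Y2) (qs_preimage polar_fst Y10)
  (qs_preimage polar_snd Y20) => w -> /= ? ?.
by rewrite !max_l.
Qed.

End marginals.

(** * Suprema of integrals and their basic estimates *)

Section sup_integral.
Context d (T : measurableType d) (R : realType) (P : set (probability T R)).
Implicit Types (X Y : L0 P) (M : set {finite_measure set T -> \bar R}).

Lemma sup_integral_leP M Y (s : \bar R) :
  (sup_integral M Y <= s)%E <-> forall mu, M mu -> (L0_integral mu Y <= s)%E.
Proof.
split => [Ms mu Mmu|Ms]; last by apply: ge_ereal_sup => _ [mu /Ms ? <-].
by apply: le_trans Ms; apply: ereal_sup_ubound; exists mu.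
Qed.

Lemma le_sup_integral M Y mu : M mu -> (L0_integral mu Y <= sup_integral M Y)%E.
Proof. by move=> Mmu; apply: ereal_sup_ubound; exists mu. Qed.

Lemma L0_integral0 (mu : {finite_measure set T -> \bar R}) :
  ca_c_pos P mu -> L0_integral mu (0 : L0 P) = 0%E.
Proof. by move=> muP; rewrite (L0_integralE muP _ (@L0_0E _ _ _ P))// integral0. Qed.

Lemma le_L0_integral (mu : {finite_measure set T -> \bar R}) X Y :
  ca_c_pos P mu -> 0 <= X -> X <= Y -> (L0_integral mu X <= L0_integral mu Y)%E.
Proof.
move=> muP X0 XY; have Y0 := le_trans X0 XY.
have mm (Z : L0 P) : measurable_fun setT (fun w => (Num.max (Z w) 0)%:E).
  by apply/measurable_EFinP/measurable_maxr => //; exact: measurable_L0.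
rewrite !L0_integral_max//; apply: ae_ge0_le_integral => //;
  try by move=> w _; rewrite lee_fin le_max lexx orbT.
move/L0_leP : XY => /(qs_ae muP); apply: filterS => w XY _.
by rewrite lee_fin ge_max !le_max XY lexx orbT.
Qed.

Lemma L0_integral_conv (mu : {finite_measure set T -> \bar R}) X Y (t : R) :
  ca_c_pos P mu -> 0 <= X -> 0 <= Y -> 0 <= t <= 1 ->
  (L0_integral mu ((1 - t) *: X + t *: Y)%R =
   (1 - t)%:E * L0_integral mu X + t%:E * L0_integral mu Y)%E.
Proof.
move=> muP X0 Y0 /andP[t0 t1].
have mm (Z : L0 P) : measurable_fun setT (fun w => Num.max (Z w) 0).
  by apply: measurable_maxr => //; exact: measurable_L0.
have max0 (r : R) : 0 <= Num.max r 0 by rewrite le_max lexx orbT.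
have t'0 : 0 <= 1 - t by rewrite subr_ge0.
have mZ (r : R) (Z : L0 P) : measurable_fun setT (fun w => r * Num.max (Z w) 0).
  exact: measurable_funM.
rewrite (L0_integralE muP (measurable_funD (mZ (1 - t) X) (mZ t Y))); last first.
  move/L0_ge0P : X0 => X0; move/L0_ge0P : Y0 => Y0.
  apply: filterS3 (filterI X0 Y0) (L0_DE ((1 - t) *: X) (t *: Y))
    (filterI (L0_ZE (1 - t) X) (L0_ZE t Y)) => w [Xw Yw] DE [Z1 Z2].
  by rewrite DE Z1 Z2 /= !max_l.
rewrite !(L0_integral_max muP)//.
have intZ (r : R) (Z : L0 P) : 0 <= r ->
    (r%:E * \int[mu]_w (Num.max (Z w) 0)%:E =
     \int[mu]_w (r * Num.max (Z w) 0)%:E)%E.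
  move=> r0; rewrite -ge0_integralZl//; first exact/measurable_EFinP.
  by move=> w _; rewrite lee_fin.
rewrite !intZ// -ge0_integralD//; try exact/measurable_EFinP;
  by move=> w _; rewrite lee_fin mulr_ge0.
Qed.

(* The zero measure lies in every polar; this rules out the value $-\infty$ of the
   supremum of an empty set. *)
Lemma sup_integral_ge0 (C : set (L0 P)) Y : 0 <= Y ->
  (0 <= sup_integral (ca_polar C) Y)%E.
Proof.
move=> Y0; pose z0 : {measure set T -> \bar R} := @mzero d T R.
have z0fin : fin_num_fun z0 by [].
pose m2 := Measure_isFinite.Build _ _ _ z0 z0fin.
pose z : {finite_measure set T -> \bar R} := HB.pack (Measure.sort z0) m2.
have int0 X : L0_integral z X = 0%E.
  rewrite /L0_integral null_set_integral//.
  exact/measurable_EFinP/measurable_L0.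
rewrite -(int0 Y); apply: ereal_sup_ubound; exists z => //; split => //.
by move=> X _; rewrite int0.
Qed.

End sup_integral.

(** * Superhedging duality *)

Section duality.
Context d1 d2 (T1 : measurableType d1) (T2 : measurableType d2) (R : realType).
Variables (P1 : set (probability T1 R)) (P2 : set (probability T2 R)).
Variables (C1 : set (L0 P1)) (C2 : set (L0 P2)).
Local Notation P := (couplings P1 P2).
Let M1 := ca_polar C1.
Let M2 := ca_polar C2.
Let M := marginals_in P1 P2 M1 M2.

(** The set [C] of the theorem; [dual_le1] below is its [D]. *)
Definition hedgeable : set (L0 P) :=
  [set Y | 0 <= Y /\ exists2 Y12, superhedges Y Y12 &
    (sup_integral M1 Y12.1 + sup_integral M2 Y12.2 <= 1)%E].

Definition dual_le1 : set (L0 P) := [set Y | 0 <= Y /\ (sup_integral M Y <= 1)%E].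

Let M1P : M1 `<=` ca_c_pos P1. Proof. by move=> mu []. Qed.
Let M2P : M2 `<=` ca_c_pos P2. Proof. by move=> mu []. Qed.
Let MP : M `<=` ca_c_pos P. Proof. by move=> mu []. Qed.

(** Both suprema are nonnegative with sum at most 1, hence finite; the real bounds [s1] and [s2]
    keep the convexity argument in [R]. *)
Lemma hedgeableP Y : hedgeable Y <-> 0 <= Y /\ exists Y1 Y2 (s1 s2 : R),
  [/\ 0 <= Y1 /\ 0 <= Y2, Y <= oplus Y1 Y2, (sup_integral M1 Y1 <= s1%:E)%E,
    (sup_integral M2 Y2 <= s2%:E)%E & s1 + s2 <= 1].
Proof.
split => [[Y0 [[Y1 Y2] [/= Y10 Y20 YY12] s12]]|
    [Y0 [Y1 [Y2 [s1 [s2 [[Y10 Y20] YY12 sY1 sY2 s12]]]]]]].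
  split => //; exists Y1, Y2.
  have := sup_integral_ge0 C1 Y10; have := sup_integral_ge0 C2 Y20; move: s12.
  case E1 : (sup_integral M1 Y1) => [s1| |]; case E2 : (sup_integral M2 Y2) => [s2| |] //.
  by move=> s12 _ _; exists s1, s2; split => //; rewrite ?E1 ?E2.
split => //; exists (Y1, Y2) => //=; apply: le_trans (leeD sY1 sY2) _.
by rewrite -EFinD lee_fin.
Qed.

Lemma conv_le_oplus (X Y : L0 P) (X1 Y1 : L0 P1) (X2 Y2 : L0 P2) (t : R) :
  0 <= t <= 1 -> X <= oplus X1 X2 -> Y <= oplus Y1 Y2 ->
  (1 - t) *: X + t *: Y <=
    oplus ((1 - t) *: X1 + t *: Y1) ((1 - t) *: X2 + t *: Y2).
Proof.
have convE d (T : measurableType d) (Q : set (probability T R)) (U V : L0 Q) :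
    \forall w \near qs Q, ((1 - t) *: U + t *: V : L0 Q) w = (1 - t) * U w + t * V w.
  apply: filterS3 (L0_DE ((1 - t) *: U) (t *: V)) (L0_ZE (1 - t) U) (L0_ZE t V) => w.
  by move=> -> -> ->.
move=> /andP[t0 t1] /L0_leP XX /L0_leP YY; apply/L0_leP.
have pf A := qs_preimage (@polar_fst _ _ _ _ _ P1 P2) (A := A).
have ps A := qs_preimage (@polar_snd _ _ _ _ _ P1 P2) (A := A).
apply: filterS3
  (filterI (convE _ _ _ X Y) (oplusE ((1 - t) *: X1 + t *: Y1) ((1 - t) *: X2 + t *: Y2)))
  (filterI (pf _ (convE _ _ _ X1 Y1)) (ps _ (convE _ _ _ X2 Y2)))
  (filterI (filterI XX (oplusE X1 X2)) (filterI YY (oplusE Y1 Y2))).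
move=> w [-> ->] [/= -> ->] [[+ XE] [+ YE]]; rewrite XE YE => Xw Yw.
have -> : (1 - t) * X1 w.1 + t * Y1 w.1 + ((1 - t) * X2 w.2 + t * Y2 w.2) =
  (1 - t) * (X1 w.1 + X2 w.2) + t * (Y1 w.1 + Y2 w.2) by ring.
by rewrite lerD// ler_wpM2l// subr_ge0.
Qed.

(** Weak duality: the integral of a superhedge against [mu] splits into integrals against its
    marginals, each bounded by a supremum. *)
Lemma hedgeable_sub : hedgeable `<=` dual_le1.
Proof.
move=> Y [Y0 [[Y1 Y2] [/= Y10 Y20 YY12] s12]]; split => //.
apply/sup_integral_leP => mu [muP [mu1 M1mu1 mu1E] [mu2 M2mu2 mu2E]].
apply: le_trans s12.
apply: le_trans (le_L0_integral muP Y0 YY12) _.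
rewrite (L0_integral_oplus muP mu1E mu2E)// leeD//; exact: le_sup_integral.
Qed.

(** For [X] in [C1] the claim [oplus X 0] is hedgeable, as [X] integrates to at most 1 under all of
    [M1]; testing [mu] on it puts the first marginal in [M1]. Likewise for [C2]. *)
Lemma ca_polar_hedgeable_sub : C1 `<=` L0_pos P1 -> C2 `<=` L0_pos P2 ->
  ca_polar hedgeable `<=` M.
Proof.
move=> C10 C20 mu [muP muC].
have [mu1 mu1E] := exists_image_measure (@measurable_fst _ _ T1 T2) mu.
have [mu2 mu2E] := exists_image_measure (@measurable_snd _ _ T1 T2) mu.
have emu1 : eq_measurable (fst_marginal mu) mu1.
  by move=> A _; rewrite fst_marginalE mu1E.
have emu2 : eq_measurable (snd_marginal mu) mu2.
  by move=> A _; rewrite snd_marginalE mu2E.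
have mu1P : ca_c_pos P1 mu1.
  by apply: (ca_c_pos_image (@polar_fst _ _ _ _ _ P1 P2)) muP => A _; rewrite mu1E.
have mu2P : ca_c_pos P2 mu2.
  by apply: (ca_c_pos_image (@polar_snd _ _ _ _ _ P1 P2)) muP => A _; rewrite mu2E.
split => //.
- exists mu1 => //; split => // X CX; have X0 := C10 _ CX.
  have := muC (oplus X 0); rewrite (L0_integral_oplus muP emu1 emu2)// L0_integral0// adde0.
  apply; split; first exact: oplus_ge0.
  exists (X, 0) => //=; rewrite -[leRHS]adde0; apply: leeD.
    by apply/sup_integral_leP => nu [_]; exact.
  by apply/sup_integral_leP => nu [nuP _]; rewrite L0_integral0.
- exists mu2 => //; split => // X CX; have X0 := C20 _ CX.
  have := muC (oplus 0 X); rewrite (L0_integral_oplus muP emu1 emu2)// L0_integral0// add0e.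
  apply; split; first exact: oplus_ge0.
  exists (0, X) => //=; rewrite -[leRHS]add0e; apply: leeD.
    by apply/sup_integral_leP => nu [nuP _]; rewrite L0_integral0.
  by apply/sup_integral_leP => nu [_]; exact.
Qed.

Lemma dual_le1E :
  dual_le1 = [set Y | 0 <= Y /\ forall mu, M mu -> (L0_integral mu Y <= 1)%E].
Proof.
by apply/seteqP; split => Y [Y0 /sup_integral_leP ?]; split.
Qed.

(** A set polar to [M] is its own bipolar, because [M] lies in its polar. *)
Lemma ca_bipolar_dual_le1 : ca_bipolar dual_le1 = dual_le1.
Proof.
apply/seteqP; split => Y [Y0 YM]; split => //.
  apply/sup_integral_leP => mu Mmu; apply: YM; split; first exact: MP.
  by move=> X [_ /sup_integral_leP]; exact.
by move=> mu [_]; apply.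
Qed.

(** Weak duality puts [M] in the polar of [hedgeable], and [ca_polar_hedgeable_sub] gives the
    converse; so the bipolar is the set polar to [M]. *)
Lemma ca_bipolar_hedgeable : C1 `<=` L0_pos P1 -> C2 `<=` L0_pos P2 ->
  ca_bipolar hedgeable = dual_le1.
Proof.
move=> C10 C20; apply/seteqP; split => Y [Y0 YM]; split => //.
  apply/sup_integral_leP => mu Mmu; apply: YM; split; first exact: MP.
  by move=> X /hedgeable_sub[_ /sup_integral_leP]; exact.
move=> mu /(ca_polar_hedgeable_sub C10 C20) Mmu; apply: le_trans YM.
exact: le_sup_integral.
Qed.

Lemma solid_hedgeable : solid hedgeable.
Proof.
move=> X Y [X0 [Y12 [Y10 Y20 XY] s12]] Y0 YX; split => //; exists Y12 => //.
by split => //; exact: le_trans XY.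
Qed.

Lemma hedgeable0 : hedgeable 0.
Proof.
split=> //; exists (0, 0) => /=; first by split => //; exact: oplus_ge0.
apply: (@le_trans _ _ (0 + 0)%E); last by rewrite adde0 lee01.
by apply: leeD; apply/sup_integral_leP => mu [muP _]; rewrite L0_integral0.
Qed.

(** Superhedges and bounds are mixed with the same weights, a supremum of integrals being convex in
    the claim. *)
Lemma convex_hedgeable X Y (t : R) : hedgeable X -> hedgeable Y -> 0 <= t <= 1 ->
  hedgeable ((1 - t) *: X + t *: Y).
Proof.
move=> /hedgeableP[X0 [X1 [X2 [r1 [r2 [[X10 X20] XX rX1 rX2 r12]]]]]].
move=> /hedgeableP[Y0 [Y1 [Y2 [s1 [s2 [[Y10 Y20] YY sY1 sY2 s12]]]]]].
move=> /[dup] t01 /andP[t0 t1]; have t'0 : 0 <= 1 - t by rewrite subr_ge0.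
have conv_ge0 d (T : measurableType d) (Q : set (probability T R)) (U V : L0 Q) :
    0 <= U -> 0 <= V -> 0 <= (1 - t) *: U + t *: V.
  move=> /L0_ge0P U0 /L0_ge0P V0; apply/L0_ge0P.
  apply: filterS3 (filterI U0 V0) (L0_DE ((1 - t) *: U) (t *: V))
    (filterI (L0_ZE (1 - t) U) (L0_ZE t V)) => w [Uw Vw] -> [-> ->].
  by rewrite addr_ge0// mulr_ge0.
have conv_sup d (T : measurableType d) (Q : set (probability T R)) (U V : L0 Q)
    (N : set {finite_measure set T -> \bar R}) (u v : R) :
    N `<=` ca_c_pos Q -> 0 <= U -> 0 <= V ->
    (sup_integral N U <= u%:E)%E -> (sup_integral N V <= v%:E)%E ->
    (sup_integral N ((1 - t) *: U + t *: V)%R <= ((1 - t) * u + t * v)%:E)%E.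
  move=> NQ U0 V0 /sup_integral_leP Nu /sup_integral_leP Nv.
  apply/sup_integral_leP => mu Nmu; rewrite (L0_integral_conv (NQ _ Nmu))//.
  by rewrite (EFinD ((1 - t) * u)) !EFinM leeD// lee_wpmul2l ?lee_fin//; [exact: Nu|exact: Nv].
apply/hedgeableP; split; first exact: conv_ge0.
exists ((1 - t) *: X1 + t *: Y1), ((1 - t) *: X2 + t *: Y2).
exists ((1 - t) * r1 + t * s1), ((1 - t) * r2 + t * s2); split.
- by split; exact: conv_ge0.
- exact: conv_le_oplus.
- exact: conv_sup.
- exact: conv_sup.
- nra.
Qed.

End duality.

Unset Implicit Arguments.

Theorem theorem7p5 (R : realType) (d1 d2 : measure_display)
    (T1 : measurableType d1) (T2 : measurableType d2)
    (P1 : set (probability T1 R)) (P2 : set (probability T2 R))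
    (C1 : set (L0 P1)) (C2 : set (L0 P2)) :
  P1 !=set0 -> P2 !=set0 ->
  C1 !=set0 -> C1 `<=` L0_pos P1 -> convex_set C1 -> solid C1 ->
  sensitive C1 -> seq_order_closed C1 ->
  C2 !=set0 -> C2 `<=` L0_pos P2 -> convex_set C2 -> solid C2 ->
  sensitive C2 -> seq_order_closed C2 ->
  let P := couplings P1 P2 in
  let M1 := ca_polar C1 in
  let M2 := ca_polar C2 in
  let M := marginals_in P1 P2 M1 M2 in
  let D : set (L0 P) :=
    [set Y | 0 <= Y /\ (sup_integral M Y <= 1)%E] in
  let C : set (L0 P) :=
    [set Y | 0 <= Y /\
      exists2 Y12, superhedges Y Y12 &
        (sup_integral M1 Y12.1 + sup_integral M2 Y12.2 <= 1)%E] in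
  (ca_bipolar C = ca_bipolar D /\ ca_bipolar D = D) /\
  (C = D <-> sensitive C /\ seq_order_closed C).
Proof.
move=> _ _ _ C10 _ _ _ _ _ C20 _ _ _ _ P M1 M2 M D C.
have CD : ca_bipolar C = D := ca_bipolar_hedgeable C10 C20.
have DD : ca_bipolar D = D := ca_bipolar_dual_le1 C1 C2.
split; first by rewrite CD DD.
split => [->|[Csens Cclosed]].
  have -> : D = _ := dual_le1E C1 C2.
  have MP : M `<=` ca_c_pos P by move=> mu [].
  split; first exact: integral_le1_sensitive.
  exact: integral_le1_seq_order_closed.
apply/seteqP; split; first exact: hedgeable_sub.
(* As [D] is the bipolar of [C], the missing inclusion is the bipolar theorem for [C] itself. *)
rewrite -CD; apply: bipolar_sub => //.
- by exists 0; exact: hedgeable0.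
- by move=> Y [].
- exact: convex_hedgeable.
- exact: solid_hedgeable.
Qed.
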